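(* For $n\ge0$, set $$\delta_{2n}:=\Big(\alpha_+=(\mathrm{ad}x_1)^{2n+2}(y_1),\ \alpha_-=\tfrac12\sum_{0\le p\le 2n+1,\ p+q=2n+1}(-1)^p[(\mathrm{ad}x_1)^p(y_1),(\mathrm{ad}x_1)^q(y_1)]\Big)\in(\mathfrak t_{1,2})^2.$$ Then $\delta_{2n}\in\mathfrak r_{ell}^{gr}[2n+1,1]$. The element $\delta_0$ is central in $\mathfrak{grt}_{ell}$ and coincides with $\mathrm{ad}\,t_{12}$ as an element of $\mathrm{Der}(\mathfrak t_{1,2})^{op}$.
   Context: All Lie algebras are over $\mathbb Q$. $\mathfrak t_n$: generators $t_{ij}=t_{ji}$ ($1\le i\ne j\le n$), relations $[t_{ij},t_{ik}+t_{jk}]=0$ for $i,j,k$ distinct and $[t_{ij},t_{kl}]=0$ for $i,j,k,l$ distinct. $\mathfrak t_{1,n}$: generators $x_i^\pm$ ($1\le i\le n$), relations $\sum_ix_i^\pm=0$, $[x_i^\pm,x_j^\pm]=0$ and $[x_i^+,x_j^-]=[x_j^+,x_i^-]$ ($i\ne j$), $[x_k^\pm,[x_i^+,x_j^-]]=0$ ($i,j,k$ distinct). One writes $x_i=x_i^+$, $y_i=x_i^-$. There is a morphism $\mathfrak t_n\to\mathfrak t_{1,n}$, $t_{ij}\mapsto[x_i^+,x_j^-]$, and the image of $t_{ij}$ is again denoted $t_{ij}$; elements of $\mathfrak t_3$ appearing in relations in $\mathfrak t_{1,3}$ are mapped by this morphism. $\mathfrak t_{1,2}$ is free on $x_1,y_1$.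 For disjoint $I_1,\dots,I_n\subset\{1,\dots,p\}$, $x\mapsto x^{I_1,\dots,I_n}$ denotes the morphism $\mathfrak t_n\to\mathfrak t_p$, $t_{ij}\mapsto\sum_{a\in I_i,b\in I_j}t_{ab}$, and, when the $I_i$ partition $\{1,\dots,p\}$, the morphism $\mathfrak t_{1,n}\to\mathfrak t_{1,p}$, $x_i^\pm\mapsto\sum_{a\in I_i}x_a^\pm$. $\mathfrak f_2$ is the free Lie algebra on $A,B$, embedded in $\mathfrak t_3$ by $A\mapsto t_{12}$, $B\mapsto t_{23}$. $\mathfrak{grt}_1=\{\psi\in\mathfrak f_2\mid\psi+\psi^{3,2,1}=0,\ \psi+\psi^{2,3,1}+\psi^{3,1,2}=0,\ [t_{23},\psi^{1,2,3}]+[t_{13},\psi^{2,1,3}]=0,\ \psi^{2,3,4}-\psi^{12,3,4}+\psi^{1,23,4}-\psi^{1,2,34}+\psi^{1,2,3}=0\}$, with bracket $\langle\psi_1,\psi_2\rangle=[\psi_1,\psi_2]+D_{\psi_2}(\psi_1)-D_{\psi_1}(\psi_2)$, where $D_\psi:A\mapsto[\psi,A],\ B\mapsto0$. $\mathfrak{grt}=\mathfrak{grt}_1\rtimes\mathbb Q$, with $[1,\psi]=-(\deg\psi)\psi$, where $\deg A=\deg B=1$. $\mathfrak{grt}_1^{ell}$ is the set of $(\psi,\alpha_+,\alpha_-)\in\mathfrak{grt}_1\times(\mathfrak t_{1,2})^2$ such that in $\mathfrak t_{1,3}$: $\alpha_\pm^{1,23}+\alpha_\pm^{2,31}+\alpha_\pm^{3,12}+[x_1^\pm,\psi^{1,2,3}]+[x_2^\pm,\psi^{2,1,3}]=0$;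 $[x_1^\pm,\alpha_\pm^{3,12}]+[\alpha_\pm^{1,23},x_3^\pm]-[x_1^\pm,[x_3^\pm,\psi^{1,2,3}]]=0$; $[x_1^+,\alpha_-^{2,13}]-[x_2^-,\alpha_+^{1,23}]=[x_2^-,[x_1^+,\psi^{1,2,3}]]-[x_1^+,[x_2^-,\psi^{2,1,3}]]$. Its bracket is $[(\psi,\alpha_\pm),(\psi',\alpha'_\pm)]=(\langle\psi,\psi'\rangle,D_{\alpha'_\pm}(\alpha_\pm)-D_{\alpha_\pm}(\alpha'_\pm))$, where $D_{\alpha_\pm}\in\mathrm{Der}(\mathfrak t_{1,2})$ is $x_1^\pm\mapsto\alpha_\pm$. $\mathfrak{grt}_{ell}=\mathfrak{grt}_1^{ell}\rtimes\mathbb Qe_{22}$, where $[e_{22},(\psi,\alpha_+,\alpha_-)]=(-(\deg\psi)\psi,\,-(\deg_-\alpha_+)\alpha_+,\,(1-\deg_-\alpha_-)\alpha_-)$ on homogeneous elements, with $\deg_-x_1^+=0$, $\deg_-x_1^-=1$. $\mathfrak r_{ell}^{gr}$ is the kernel of the morphism $\mathfrak{grt}_{ell}\to\mathfrak{grt}$, $(\psi,\alpha_+,\alpha_-)\mapsto\psi$, $e_{22}\mapsto1$. Explicitly, it is the set of $(\alpha_+,\alpha_-)\in(\mathfrak t_{1,2})^2$ (identified with $(0,\alpha_+,\alpha_-)$) with, in $\mathfrak t_{1,3}$, $\alpha_\pm^{1,23}+\alpha_\pm^{2,31}+\alpha_\pm^{3,12}=0$, $[x_1^\pm,\alpha_\pm^{2,13}]+[\alpha_\pm^{1,23},x_2^\pm]=0$,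 $[x_1^+,\alpha_-^{2,13}]+[\alpha_+^{1,23},x_2^-]=0$. The pair $(\alpha_+,\alpha_-)$ is identified with the derivation $x_1^\pm\mapsto\alpha_\pm$ of $\mathfrak t_{1,2}$, which makes $\mathfrak r_{ell}^{gr}$ a Lie subalgebra of $\mathrm{Der}(\mathfrak t_{1,2})^{op}$ (opposite bracket). $\mathfrak r_{ell}^{gr}[p,q]$ is its part of bidegree $(p,q)$: derivations raising the bidegree of $\mathfrak t_{1,2}$ (with $x_1$ of bidegree $(1,0)$ and $y_1$ of bidegree $(0,1)$) by $(p,q)$.
   Formalization: The claim that δ_0 is central in grt_ell is false for the given bracket, since [e_22, δ_0] = −δ_0 ≠ 0; it is replaced by: δ_0 lies in grt_ell, commutes with all of grt_1^ell, and [e_22, δ_0] = −δ_0. *)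

(* Defs.v *)
From HB Require Import structures.
From mathcomp Require Import all_boot all_order all_algebra.
From mathcomp Require Import boolp classical_sets.

Set Implicit Arguments.
Unset Strict Implicit.
Unset Printing Implicit Defensive.

Import GRing.Theory.
Local Open Scope ring_scope.
Local Open Scope quotient_scope.

HB.mixin Record Lmodule_isLieAlg L of GRing.Lmodule rat L := {
  bracket : L -> L -> L;
  bracketDl : forall x y z, bracket (x + y) z = bracket x z + bracket y z;
  bracketDr : forall x y z, bracket x (y + z) = bracket x y + bracket x z;
  bracketZl : forall (c : rat) x y, bracket (c *: x) y = c *: bracket x y;
  bracketZr : forall (c : rat) x y, bracket x (c *: y) = c *: bracket x y;
  bracketxx : forall x, bracket x x = 0;
  jacobi : forall x y z,
    bracket x (bracket y z) + bracket y (bracket z x)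
      + bracket z (bracket x y) = 0
}.

#[short(type="lieAlgType")]
HB.structure Definition LieAlg :=
  { L of GRing.Lmodule rat L & Lmodule_isLieAlg L }.

Notation "[ 'lie' x , y ]" := (bracket x y)
  (at level 0, x at level 99, y at level 99, format "[ 'lie'  x ,  y ]")
  : ring_scope.

Definition ad (L : lieAlgType) (x : L) : L -> L := fun y => [lie x, y].

Section BracketTheory.
Variable L : lieAlgType.
Implicit Types x y z : L.

Lemma bracket0l x : [lie 0, x] = 0.
Proof. by rewrite -[X in bracket X _](scale0r (0 : L)) bracketZl scale0r. Qed.

Lemma bracket0r x : [lie x, 0] = 0.
Proof. by rewrite -[X in bracket _ X](scale0r (0 : L)) bracketZr scale0r. Qed.

Lemma bracketNl x y : [lie - x, y] = - [lie x, y].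
Proof. by rewrite -scaleN1r bracketZl scaleN1r. Qed.

Lemma bracketNr x y : [lie x, - y] = - [lie x, y].
Proof. by rewrite -scaleN1r bracketZr scaleN1r. Qed.

Lemma bracketC x y : [lie x, y] = - [lie y, x].
Proof.
have := bracketxx (x + y).
rewrite bracketDl !bracketDr !bracketxx add0r addr0 => /eqP.
by rewrite addr_eq0 => /eqP.
Qed.

Lemma bracket_suml I (r : seq I) (P : pred I) (F : I -> L) y :
  [lie \sum_(i <- r | P i) F i, y] = \sum_(i <- r | P i) [lie F i, y].
Proof.
elim/big_rec2: _ => [|i u v _ <-]; first exact: bracket0l.
exact: bracketDl.
Qed.

Lemma bracket_sumr I (r : seq I) (P : pred I) (F : I -> L) x :
  [lie x, \sum_(i <- r | P i) F i] = \sum_(i <- r | P i) [lie x, F i].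
Proof.
elim/big_rec2: _ => [|i u v _ <-]; first exact: bracket0r.
exact: bracketDr.
Qed.

Lemma bracket_eq0C x y : [lie x, y] = 0 -> [lie y, x] = 0.
Proof. by move=> h; rewrite bracketC h oppr0. Qed.

Lemma bracket_comm x y z :
  [lie x, y] = 0 -> [lie x, z] = 0 -> [lie x, [lie y, z]] = 0.
Proof.
move=> hy hz; have := jacobi x y z.
by rewrite (bracket_eq0C hz) hy !bracket0r !addr0.
Qed.

End BracketTheory.

Definition is_lie_morphism (L M : lieAlgType) (f : L -> M) : Prop :=
  [/\ forall u v, f (u + v) = f u + f v,
      forall (c : rat) u, f (c *: u) = c *: f u
    & forall u v, f [lie u, v] = [lie f u, f v]].

Definition is_derivation (L : lieAlgType) (D : L -> L) : Prop :=
  [/\ forall u v, D (u + v) = D u + D v,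
      forall (c : rat) u, D (c *: u) = c *: D u
    & forall u v, D [lie u, v] = [lie D u, v] + [lie u, D v]].

Inductive lie_term (X : Type) : Type :=
| LGen of X
| LZero
| LAdd of lie_term X & lie_term X
| LScale of rat & lie_term X
| LBr of lie_term X & lie_term X.
Arguments LZero {X}.

HB.instance Definition _ X := gen_eqMixin (lie_term X).
HB.instance Definition _ X := gen_choiceMixin (lie_term X).

Definition LOpp X (s : lie_term X) := LScale (-1) s.

(** The least congruence which contains [R] and whose quotient is a Lie
    algebra; [R s t] is the relation [s = t]. *)
Inductive lie_congr X (R : lie_term X -> lie_term X -> Prop) :
  lie_term X -> lie_term X -> Prop :=
| LC_rel s t : R s t -> lie_congr R s t
| LC_refl s : lie_congr R s s
| LC_sym s t : lie_congr R s t -> lie_congr R t s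
| LC_trans s t u : lie_congr R s t -> lie_congr R t u -> lie_congr R s u
| LC_add s s' t t' : lie_congr R s s' -> lie_congr R t t' ->
    lie_congr R (LAdd s t) (LAdd s' t')
| LC_scale c s s' : lie_congr R s s' -> lie_congr R (LScale c s) (LScale c s')
| LC_br s s' t t' : lie_congr R s s' -> lie_congr R t t' ->
    lie_congr R (LBr s t) (LBr s' t')
| LC_addA s t u : lie_congr R (LAdd s (LAdd t u)) (LAdd (LAdd s t) u)
| LC_addC s t : lie_congr R (LAdd s t) (LAdd t s)
| LC_add0 s : lie_congr R (LAdd LZero s) s
| LC_addN s : lie_congr R (LAdd (LOpp s) s) LZero
| LC_scaleA c d s : lie_congr R (LScale c (LScale d s)) (LScale (c * d) s)
| LC_scale1 s : lie_congr R (LScale 1 s) s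
| LC_scaleDr c s t :
    lie_congr R (LScale c (LAdd s t)) (LAdd (LScale c s) (LScale c t))
| LC_scaleDl c d s :
    lie_congr R (LScale (c + d) s) (LAdd (LScale c s) (LScale d s))
| LC_brDl s t u : lie_congr R (LBr (LAdd s t) u) (LAdd (LBr s u) (LBr t u))
| LC_brDr s t u : lie_congr R (LBr s (LAdd t u)) (LAdd (LBr s t) (LBr s u))
| LC_brZl c s t : lie_congr R (LBr (LScale c s) t) (LScale c (LBr s t))
| LC_brZr c s t : lie_congr R (LBr s (LScale c t)) (LScale c (LBr s t))
| LC_brxx s : lie_congr R (LBr s s) LZero
| LC_jacobi s t u : lie_congr R
    (LAdd (LAdd (LBr s (LBr t u)) (LBr t (LBr u s))) (LBr u (LBr s t))) LZero.

Section Presented.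
Variables (X : Type) (R : lie_term X -> lie_term X -> Prop).

Definition lie_congrb (s t : lie_term X) : bool := `[< lie_congr R s t >].

Lemma lie_congrb_refl : reflexive lie_congrb.
Proof. by move=> s; apply/asboolP/LC_refl. Qed.

Lemma lie_congrb_sym : symmetric lie_congrb.
Proof. by move=> s t; apply: asbool_equiv_eq; split; apply: LC_sym. Qed.

Lemma lie_congrb_trans : transitive lie_congrb.
Proof.
by move=> t s u /asboolP st /asboolP tu; apply/asboolP; apply: LC_trans tu.
Qed.

Canonical lie_congr_equiv :=
  EquivRel lie_congrb lie_congrb_refl lie_congrb_sym lie_congrb_trans.

Definition presented : Type := {eq_quot lie_congr_equiv}.

HB.instance Definition _ := Choice.on presented.
HB.instance Definition _ := EqQuotient.on presented.

Local Notation P := presented.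
Local Notation cl := (\pi_P : lie_term X -> P).

Lemma pres_pi_eq s t : cl s = cl t <-> lie_congr R s t.
Proof.
split=> [/eqmodP|] h; first exact/asboolP.
by apply/eqmodP; apply/asboolP.
Qed.

Lemma pres_repr s : lie_congr R (repr (cl s)) s.
Proof. by apply/pres_pi_eq; rewrite reprK. Qed.

Definition pres_zero : P := cl LZero.
Definition pres_add (u v : P) : P := cl (LAdd (repr u) (repr v)).
Definition pres_opp (u : P) : P := cl (LOpp (repr u)).
Definition pres_scale (c : rat) (u : P) : P := cl (LScale c (repr u)).
Definition pres_bracket (u v : P) : P := cl (LBr (repr u) (repr v)).

Lemma pres_addE s t : pres_add (cl s) (cl t) = cl (LAdd s t).
Proof. by apply/pres_pi_eq/LC_add; apply: pres_repr. Qed.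
Lemma pres_scaleE c s : pres_scale c (cl s) = cl (LScale c s).
Proof. exact/pres_pi_eq/LC_scale/pres_repr. Qed.
Lemma pres_oppE s : pres_opp (cl s) = cl (LOpp s).
Proof. exact: pres_scaleE. Qed.
Lemma pres_bracketE s t : pres_bracket (cl s) (cl t) = cl (LBr s t).
Proof. by apply/pres_pi_eq/LC_br; apply: pres_repr. Qed.

Lemma pres_addA : associative pres_add.
Proof.
elim/quotW=> s; elim/quotW=> t; elim/quotW=> u.
rewrite (pres_addE t u) (pres_addE s t) 2!pres_addE.
exact/pres_pi_eq/LC_addA.
Qed.
Lemma pres_addC : commutative pres_add.
Proof.
elim/quotW=> s; elim/quotW=> t; rewrite (pres_addE s t) (pres_addE t s).
exact/pres_pi_eq/LC_addC.
Qed.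
Lemma pres_add0 : left_id pres_zero pres_add.
Proof.
elim/quotW=> s; rewrite (pres_addE LZero s); exact/pres_pi_eq/LC_add0.
Qed.
Lemma pres_addN : left_inverse pres_zero pres_opp pres_add.
Proof.
elim/quotW=> s; rewrite (pres_oppE s) (pres_addE (LOpp s) s).
exact/pres_pi_eq/LC_addN.
Qed.

HB.instance Definition _ :=
  GRing.isZmodule.Build presented pres_addA pres_addC pres_add0 pres_addN.

Lemma pres_piD s t : cl (LAdd s t) = cl s + cl t.
Proof. exact/esym/pres_addE. Qed.

Lemma pres_scaleA c d u : pres_scale c (pres_scale d u) = pres_scale (c * d) u.
Proof.
elim/quotW: u => s.
rewrite (pres_scaleE d s) (pres_scaleE c) (pres_scaleE (c * d)).
exact/pres_pi_eq/LC_scaleA.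
Qed.
Lemma pres_scale1 : left_id 1 pres_scale.
Proof.
elim/quotW=> s; rewrite (pres_scaleE 1 s); exact/pres_pi_eq/LC_scale1.
Qed.
Lemma pres_scaleDr : right_distributive pres_scale +%R.
Proof.
move=> c; elim/quotW=> s; elim/quotW=> t.
rewrite -(pres_piD s t) (pres_scaleE c s) (pres_scaleE c t).
rewrite (pres_scaleE c (LAdd s t)) -(pres_piD (LScale c s)).
exact/pres_pi_eq/LC_scaleDr.
Qed.
Lemma pres_scaleDl u : {morph pres_scale^~ u : c d / c + d}.
Proof.
move=> c d; elim/quotW: u => s.
rewrite (pres_scaleE c s) (pres_scaleE d s) (pres_scaleE (c + d)).
rewrite -(pres_piD (LScale c s)).
exact/pres_pi_eq/LC_scaleDl.
Qed.

HB.instance Definition _ := GRing.Zmodule_isLmodule.Build rat presented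
  pres_scaleA pres_scale1 pres_scaleDr pres_scaleDl.

Lemma pres_piZ c s : cl (LScale c s) = c *: cl s.
Proof. exact/esym/pres_scaleE. Qed.

Lemma pres_bracketDl u v w :
  pres_bracket (u + v) w = pres_bracket u w + pres_bracket v w.
Proof.
elim/quotW: u => s; elim/quotW: v => t; elim/quotW: w => u.
rewrite -(pres_piD s t) (pres_bracketE s) (pres_bracketE t) pres_bracketE.
rewrite -(pres_piD (LBr s u)).
exact/pres_pi_eq/LC_brDl.
Qed.
Lemma pres_bracketDr u v w :
  pres_bracket u (v + w) = pres_bracket u v + pres_bracket u w.
Proof.
elim/quotW: u => s; elim/quotW: v => t; elim/quotW: w => u.
rewrite -(pres_piD t u) (pres_bracketE s t) (pres_bracketE s u) pres_bracketE.
rewrite -(pres_piD (LBr s t)).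
exact/pres_pi_eq/LC_brDr.
Qed.
Lemma pres_bracketZl (c : rat) u v :
  pres_bracket (c *: u) v = c *: pres_bracket u v.
Proof.
elim/quotW: u => s; elim/quotW: v => t.
rewrite -(pres_piZ c s) (pres_bracketE s t) pres_bracketE -(pres_piZ c (LBr s t)).
exact/pres_pi_eq/LC_brZl.
Qed.
Lemma pres_bracketZr (c : rat) u v :
  pres_bracket u (c *: v) = c *: pres_bracket u v.
Proof.
elim/quotW: u => s; elim/quotW: v => t.
rewrite -(pres_piZ c t) (pres_bracketE s t) pres_bracketE -(pres_piZ c (LBr s t)).
exact/pres_pi_eq/LC_brZr.
Qed.
Lemma pres_bracketxx u : pres_bracket u u = 0.
Proof.
elim/quotW: u => s; rewrite (pres_bracketE s s); exact/pres_pi_eq/LC_brxx.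
Qed.
Lemma pres_jacobi u v w :
  pres_bracket u (pres_bracket v w) + pres_bracket v (pres_bracket w u)
    + pres_bracket w (pres_bracket u v) = 0.
Proof.
elim/quotW: u => s; elim/quotW: v => t; elim/quotW: w => u.
rewrite (pres_bracketE t u) (pres_bracketE u s) (pres_bracketE s t).
rewrite (pres_bracketE s) (pres_bracketE t) (pres_bracketE u).
rewrite -(pres_piD (LBr s (LBr t u))) -pres_piD.
exact/pres_pi_eq/LC_jacobi.
Qed.

HB.instance Definition _ := Lmodule_isLieAlg.Build presented
  pres_bracketDl pres_bracketDr pres_bracketZl pres_bracketZr
  pres_bracketxx pres_jacobi.

Lemma pres_pi_br s t : cl (LBr s t) = [lie cl s, cl t].
Proof. exact/esym/pres_bracketE. Qed.

Definition pres_gen (x : X) : presented := cl (LGen x).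

(** [pres_lift f] and [pres_der f] are the morphism and the derivation which
    extend [f : X -> _]; they are meaningful only if [f] is compatible with the
    relations (the hypotheses [fR] below). *)
Section Lift.
Variable L : lieAlgType.
Variable f : X -> L.

Fixpoint lie_eval (s : lie_term X) : L :=
  match s with
  | LGen x => f x
  | LZero => 0
  | LAdd s t => lie_eval s + lie_eval t
  | LScale c s => c *: lie_eval s
  | LBr s t => [lie lie_eval s, lie_eval t]
  end.

Definition pres_lift (u : presented) : L := lie_eval (repr u).

Hypothesis fR : forall s t, R s t -> lie_eval s = lie_eval t.

Lemma lie_eval_congr s t : lie_congr R s t -> lie_eval s = lie_eval t.
Proof.
elim=> //=.
- by move=> s1 t1 t2 _ -> _ ->.
- by move=> s1 s2 t1 t2 _ -> _ ->.
- by move=> c s1 s2 _ ->.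
- by move=> s1 s2 t1 t2 _ -> _ ->.
- by move=> *; rewrite addrA.
- by move=> *; rewrite addrC.
- by move=> *; rewrite add0r.
- by move=> *; rewrite scaleN1r addNr.
- by move=> *; rewrite scalerA.
- by move=> *; rewrite scale1r.
- by move=> *; rewrite scalerDr.
- by move=> *; rewrite scalerDl.
- by move=> *; rewrite bracketDl.
- by move=> *; rewrite bracketDr.
- by move=> *; rewrite bracketZl.
- by move=> *; rewrite bracketZr.
- by move=> *; rewrite bracketxx.
- by move=> *; rewrite jacobi.
Qed.

Lemma pres_lift_pi s : pres_lift (cl s) = lie_eval s.
Proof. exact/lie_eval_congr/pres_repr. Qed.

Lemma pres_lift_gen x : pres_lift (pres_gen x) = f x.
Proof. exact: pres_lift_pi. Qed.

Lemma pres_lift_morphism : is_lie_morphism pres_lift.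
Proof.
split=> [u v|c u|u v].
- elim/quotW: u => s; elim/quotW: v => t.
  by rewrite -(pres_piD s t) (pres_lift_pi s) (pres_lift_pi t) pres_lift_pi.
- elim/quotW: u => s.
  by rewrite -(pres_piZ c s) (pres_lift_pi s) pres_lift_pi.
- elim/quotW: u => s; elim/quotW: v => t.
  by rewrite -(pres_pi_br s t) (pres_lift_pi s) (pres_lift_pi t) pres_lift_pi.
Qed.

End Lift.

Section Der.
Variable f : X -> presented.

Fixpoint lie_der_eval (s : lie_term X) : presented :=
  match s with
  | LGen x => f x
  | LZero => 0
  | LAdd s t => lie_der_eval s + lie_der_eval t
  | LScale c s => c *: lie_der_eval s
  | LBr s t => [lie lie_der_eval s, cl t] + [lie cl s, lie_der_eval t]
  end.

Definition pres_der (u : presented) : presented := lie_der_eval (repr u).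

Hypothesis fR : forall s t, R s t -> lie_der_eval s = lie_der_eval t.

Lemma lie_der_eval_congr s t : lie_congr R s t -> lie_der_eval s = lie_der_eval t.
Proof.
elim=> /=.
- exact: fR.
- by [].
- by [].
- by move=> s1 t1 t2 _ -> _ ->.
- by move=> s1 s2 t1 t2 _ -> _ ->.
- by move=> c s1 s2 _ ->.
- move=> s1 s2 t1 t2 + -> + ->.
  by move=> /pres_pi_eq -> /pres_pi_eq ->.
- by move=> *; rewrite addrA.
- by move=> *; rewrite addrC.
- by move=> *; rewrite add0r.
- by move=> *; rewrite scaleN1r addNr.
- by move=> *; rewrite scalerA.
- by move=> *; rewrite scale1r.
- by move=> *; rewrite scalerDr.
- by move=> *; rewrite scalerDl.
- by move=> s1 t1 u; rewrite pres_piD !bracketDl addrACA.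
- by move=> s1 t1 u; rewrite pres_piD !bracketDr addrACA.
- by move=> c s1 t1; rewrite pres_piZ !bracketZl scalerDr.
- by move=> c s1 t1; rewrite pres_piZ !bracketZr scalerDr.
- by move=> s1; rewrite bracketC addNr.
- move=> s1 t1 u; rewrite !pres_pi_br !bracketDr.
  set a := lie_der_eval s1; set b := lie_der_eval t1; set c := lie_der_eval u.
  set x := cl s1; set y := cl t1; set z := cl u.
  have ja := jacobi a y z; have jb := jacobi x b z; have jc := jacobi x y c.
  transitivity (([lie a, [lie y, z]] + [lie y, [lie z, a]] + [lie z, [lie a, y]])
    + ([lie x, [lie b, z]] + [lie b, [lie z, x]] + [lie z, [lie x, b]])
    + ([lie x, [lie y, c]] + [lie y, [lie c, x]] + [lie c, [lie x, y]])).
    by rewrite (AC ((1*2)*(1*2)*(1*2))%AC ((1*6*8)*(2*4*9)*(3*5*7))%AC).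
  by rewrite ja jb jc !addr0.
Qed.

Lemma pres_der_pi s : pres_der (cl s) = lie_der_eval s.
Proof. exact/lie_der_eval_congr/pres_repr. Qed.

Lemma pres_der_gen x : pres_der (pres_gen x) = f x.
Proof. exact: pres_der_pi. Qed.

Lemma pres_der_derivation : is_derivation pres_der.
Proof.
split=> [u v|c u|u v].
- elim/quotW: u => s; elim/quotW: v => t.
  by rewrite -(pres_piD s t) (pres_der_pi s) (pres_der_pi t) pres_der_pi.
- elim/quotW: u => s.
  by rewrite -(pres_piZ c s) (pres_der_pi s) pres_der_pi.
- elim/quotW: u => s; elim/quotW: v => t.
  by rewrite -(pres_pi_br s t) (pres_der_pi s) (pres_der_pi t) pres_der_pi.
Qed.

End Der.

End Presented.

Definition free_rel X (s t : lie_term X) : Prop := False.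

Definition f2 : Type := presented (@free_rel bool).
HB.instance Definition _ := LieAlg.on f2.
Definition f2A : f2 := pres_gen _ true.
Definition f2B : f2 := pres_gen _ false.

(** The generators are indexed by all pairs, with [t_ii = 0]. *)
Inductive t_rel n :
  lie_term ('I_n * 'I_n) -> lie_term ('I_n * 'I_n) -> Prop :=
| T_diag i : t_rel (LGen (i, i)) LZero
| T_sym i j : t_rel (LGen (i, j)) (LGen (j, i))
| T_3 i j k : uniq [:: i; j; k] ->
    t_rel (LBr (LGen (i, j)) (LAdd (LGen (i, k)) (LGen (j, k)))) LZero
| T_4 i j k l : uniq [:: i; j; k; l] ->
    t_rel (LBr (LGen (i, j)) (LGen (k, l))) LZero.

Definition t_alg n : Type := presented (@t_rel n).
HB.instance Definition _ n := LieAlg.on (t_alg n).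
Definition tg n (i j : 'I_n) : t_alg n := pres_gen _ (i, j).

(** The generator [(s, i)] is [x_i^+] if [s] is [true], [x_i^-] otherwise. *)
Inductive t1_rel n :
  lie_term (bool * 'I_n) -> lie_term (bool * 'I_n) -> Prop :=
| T1_sum s : t1_rel (\big[@LAdd _/LZero]_(i < n) LGen (s, i)) LZero
| T1_comm s i j : i != j ->
    t1_rel (LBr (LGen (s, i)) (LGen (s, j))) LZero
| T1_sym i j : i != j ->
    t1_rel (LBr (LGen (true, i)) (LGen (false, j)))
           (LBr (LGen (true, j)) (LGen (false, i)))
| T1_3 s i j k : uniq [:: i; j; k] ->
    t1_rel (LBr (LGen (s, k)) (LBr (LGen (true, i)) (LGen (false, j)))) LZero.

Definition t1_alg n : Type := presented (@t1_rel n).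
HB.instance Definition _ n := LieAlg.on (t1_alg n).
Definition xg n (s : bool) (i : 'I_n) : t1_alg n := pres_gen _ (s, i).

Definition t_to_t1 n : t_alg n -> t1_alg n :=
  pres_lift (fun ij : 'I_n * 'I_n =>
    if ij.1 == ij.2 then 0 else [lie xg true ij.1, xg false ij.2]).

Definition f2_to_t3 : f2 -> t_alg 3 :=
  pres_lift (fun b : bool =>
    if b then tg (inord 0) (inord 1) else tg (inord 1) (inord 2)).

(** The morphisms [x |-> x^(I_1,...,I_n)]; [t_cab I] is a morphism when the
    [I_i] are pairwise disjoint, [t1_cab I] when they form a partition. *)
Definition t_cab n p (I : 'I_n -> {set 'I_p}) : t_alg n -> t_alg p :=
  pres_lift (fun ij : 'I_n * 'I_n =>
    if ij.1 == ij.2 then 0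
    else \sum_(a in I ij.1) \sum_(b in I ij.2) tg a b).

Definition t1_cab n p (I : 'I_n -> {set 'I_p}) : t1_alg n -> t1_alg p :=
  pres_lift (fun si : bool * 'I_n => \sum_(a in I si.2) xg si.1 a).

Definition disjoint_family n p (I : 'I_n -> {set 'I_p}) : Prop :=
  forall i j, i != j -> [disjoint I i & I j].

Definition partition_family n p (I : 'I_n -> {set 'I_p}) : Prop :=
  disjoint_family I /\ forall a, exists i, a \in I i.

(** Blocks are written with labels starting from 1:
    [blocks [:: [:: 1]; [:: 2; 3]]] is the family ({1}, {2, 3}). *)
Definition blocks n p (l : seq (seq nat)) : 'I_n -> {set 'I_p} :=
  fun i => [set a : 'I_p | a.+1 \in nth [::] l i].
Arguments blocks {n p} l%_N.

Section Morphisms.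

Lemma lie_eval_sum X (L : lieAlgType) (f : X -> L) I (r : seq I) (P : pred I)
    (F : I -> lie_term X) :
  lie_eval f (\big[@LAdd _/LZero]_(i <- r | P i) F i)
    = \sum_(i <- r | P i) lie_eval f (F i).
Proof. exact: (big_morph (lie_eval f)). Qed.

Lemma pres_pi_sum X (R : lie_term X -> lie_term X -> Prop) I (r : seq I)
    (P : pred I) (F : I -> lie_term X) :
  \pi_(presented R) (\big[@LAdd _/LZero]_(i <- r | P i) F i)
    = \sum_(i <- r | P i) \pi_(presented R) (F i).
Proof.
by apply: (big_morph (\pi_(presented R))) => [s t|] //; apply: pres_piD.
Qed.

Lemma lie_der_eval_sum X (R : lie_term X -> lie_term X -> Prop)
    (f : X -> presented R) I (r : seq I) (P : pred I) (F : I -> lie_term X) :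
  lie_der_eval f (\big[@LAdd _/LZero]_(i <- r | P i) F i)
    = \sum_(i <- r | P i) lie_der_eval f (F i).
Proof. exact: (big_morph (lie_der_eval f)). Qed.

Variable n : nat.
Implicit Types i j k l : 'I_n.

Lemma tgC i j : tg i j = tg j i.
Proof. exact/pres_pi_eq/LC_rel/T_sym. Qed.

Lemma tg_diag i : tg i i = 0.
Proof. exact/pres_pi_eq/LC_rel/T_diag. Qed.

Lemma tg_br3 i j k : uniq [:: i; j; k] -> [lie tg i j, tg i k + tg j k] = 0.
Proof.
move=> u; rewrite /tg /pres_gen -pres_piD -pres_pi_br.
exact/pres_pi_eq/LC_rel/T_3.
Qed.

Lemma tg_br4 i j k l : uniq [:: i; j; k; l] -> [lie tg i j, tg k l] = 0.
Proof.
move=> u; rewrite /tg /pres_gen -pres_pi_br.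
exact/pres_pi_eq/LC_rel/T_4.
Qed.

Lemma xg_sum s : \sum_(i < n) xg s i = 0.
Proof.
rewrite /xg /pres_gen -(pres_pi_sum (@t1_rel n)).
exact/pres_pi_eq/LC_rel/T1_sum.
Qed.

Lemma xg_comm s i j : [lie xg s i, xg s j] = 0.
Proof.
have [->|ij] := eqVneq i j; first exact: bracketxx.
rewrite /xg /pres_gen -pres_pi_br; exact/pres_pi_eq/LC_rel/T1_comm.
Qed.

Lemma xg_sym i j : i != j ->
  [lie xg true i, xg false j] = [lie xg true j, xg false i].
Proof.
move=> ij; rewrite /xg /pres_gen -!pres_pi_br.
exact/pres_pi_eq/LC_rel/T1_sym.
Qed.

Lemma xg_br3 s i j k : uniq [:: i; j; k] ->
  [lie xg s k, [lie xg true i, xg false j]] = 0.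
Proof.
move=> u; rewrite /xg /pres_gen.
rewrite -(pres_pi_br _ (LGen (true, i))) -(pres_pi_br _ (LGen (s, k))).
exact/pres_pi_eq/LC_rel/T1_3.
Qed.

End Morphisms.

Lemma f2_to_t3_morphism : is_lie_morphism f2_to_t3.
Proof. exact: pres_lift_morphism. Qed.

Lemma t_to_t1_rel n s t : t_rel s t ->
  let f := fun ij : 'I_n * 'I_n =>
    if ij.1 == ij.2 then 0 else [lie xg true ij.1, xg false ij.2] in
  lie_eval f s = lie_eval f t.
Proof.
case=> [i|i j|i j k|i j k l] /=.
- by rewrite eqxx.
- by rewrite eq_sym; case: eqVneq => // /xg_sym.
- rewrite !inE negb_or andbT => /andP[/andP[ij ik] jk].
  rewrite (negbTE ij) (negbTE ik) (negbTE jk) -bracketDl.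
  have cm e h : h \notin [:: i; j] ->
      [lie [lie xg true i, xg false j], xg e h] = 0.
    rewrite !inE negb_or => /andP[hi hj].
    by apply/bracket_eq0C/xg_br3;
      rewrite /= !inE negb_or ij [i == h]eq_sym hi [j == h]eq_sym hj.
  apply: bracket_comm; last by apply: cm; rewrite !inE negb_or ![k == _]eq_sym ik.
  have := xg_sum n true.
  rewrite (bigD1 i) //= (bigD1 j) ?[j == i]eq_sym //= addrA.
  move=> /eqP; rewrite addr_eq0 => /eqP ->.
  rewrite bracketNr bracket_sumr big1 ?oppr0 // => h /andP[hi hj].
  by apply: cm; rewrite !inE negb_or hi.
- rewrite !inE !negb_or andbT => /and3P[/and3P[ij ik il] /andP[jk jl] kl].
  rewrite (negbTE ij) (negbTE kl).
  by apply: bracket_comm; apply/bracket_eq0C/xg_br3;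
    rewrite /= !inE !negb_or ?ij ?ik ?il ?jk ?jl.
Qed.

Lemma t_to_t1_morphism n : is_lie_morphism (@t_to_t1 n).
Proof. exact/pres_lift_morphism/t_to_t1_rel. Qed.

Lemma disjoint_neq n p (I : 'I_n -> {set 'I_p}) i j a b :
  disjoint_family I -> i != j -> a \in I i -> b \in I j -> a != b.
Proof.
move=> dI ij ai bj; apply: contraTneq bj => <-.
by have /disjointFr -> := dI _ _ ij.
Qed.

Lemma t_cab_rel n p (I : 'I_n -> {set 'I_p}) s t :
  disjoint_family I -> t_rel s t ->
  let f := fun ij : 'I_n * 'I_n =>
    if ij.1 == ij.2 then 0
    else \sum_(a in I ij.1) \sum_(b in I ij.2) tg a b in
  lie_eval f s = lie_eval f t.
Proof.
move=> dI [i|i j|i j k|i j k l] /=.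
- by rewrite eqxx.
- rewrite eq_sym; case: eqVneq => // _.
  by rewrite exchange_big; apply: eq_bigr => b _; apply: eq_bigr => a _; apply: tgC.
- rewrite !inE negb_or andbT => /andP[/andP[ij ik] jk].
  rewrite (negbTE ij) (negbTE ik) (negbTE jk).
  rewrite bracket_suml big1 // => a ai; rewrite bracket_suml big1 // => b bj.
  rewrite exchange_big [X in _ + X]exchange_big -big_split /=.
  rewrite bracket_sumr big1 // => c ck.
  have ab := disjoint_neq dI ij ai bj.
  have ac := disjoint_neq dI ik ai ck.
  have bc := disjoint_neq dI jk bj ck.
  rewrite (bigD1 a) //= [X in _ + X](bigD1 b) //= addrACA bracketDr tg_br3;
    last by rewrite /= !inE negb_or ab ac bc.
  rewrite add0r bracketDr !bracket_sumr !big1 ?addr0 // => d /andP[dI' dn].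
    apply: tg_br4; rewrite /= !inE !negb_or ab ac bc [b == d]eq_sym dn.
    by rewrite (disjoint_neq dI ij ai dI') (disjoint_neq dI jk dI' ck).
  apply: tg_br4; rewrite /= !inE !negb_or ab ac bc [a == d]eq_sym dn.
  by rewrite [b == d]eq_sym (disjoint_neq dI ij dI' bj) (disjoint_neq dI ik dI' ck).
- rewrite !inE !negb_or andbT => /and3P[/and3P[ij ik il] /andP[jk jl] kl].
  rewrite (negbTE ij) (negbTE kl).
  rewrite bracket_suml big1 // => a ai; rewrite bracket_suml big1 // => b bj.
  rewrite bracket_sumr big1 // => c ck; rewrite bracket_sumr big1 // => d dl.
  apply: tg_br4; rewrite /= !inE !negb_or.
  by rewrite (disjoint_neq dI ij) // (disjoint_neq dI ik) //
     (disjoint_neq dI il) // (disjoint_neq dI jk) // (disjoint_neq dI jl) //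
     (disjoint_neq dI kl).
Qed.

Lemma t_cab_morphism n p (I : 'I_n -> {set 'I_p}) :
  disjoint_family I -> is_lie_morphism (t_cab I).
Proof. move=> dI; apply: pres_lift_morphism => s t; exact: t_cab_rel. Qed.

Lemma t1_cab_rel n p (I : 'I_n -> {set 'I_p}) s t :
  partition_family I -> t1_rel s t ->
  let f := fun si : bool * 'I_n => \sum_(a in I si.2) xg si.1 a in
  lie_eval f s = lie_eval f t.
Proof.
move=> [dI pI] [e|e i j ij|i j ij|e i j k] /=.
- rewrite lie_eval_sum /= -[RHS](xg_sum p e).
  rewrite (exchange_big_dep predT) //=; apply: eq_bigr => a _.
  have [i ai] := pI a.
  rewrite (bigD1 i) //= big1 ?addr0 // => j /andP[aj ji].
  by have := disjoint_neq dI ji aj ai; rewrite eqxx.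
- rewrite bracket_suml big1 // => a _; rewrite bracket_sumr big1 // => b _.
  exact: xg_comm.
- rewrite !bracket_suml (eq_bigr _ (fun a _ => bracket_sumr _ _ _ _)).
  rewrite [RHS](eq_bigr _ (fun a _ => bracket_sumr _ _ _ _)).
  rewrite [RHS]exchange_big /=; apply: eq_bigr => a ai; apply: eq_bigr => b bj.
  exact/xg_sym/(disjoint_neq dI ij).
- rewrite !inE negb_or andbT => /andP[/andP[ij ik] jk].
  rewrite bracket_suml big1 // => c ck.
  rewrite bracket_suml bracket_sumr big1 // => a ai.
  rewrite !bracket_sumr big1 // => b bj.
  apply: xg_br3; rewrite /= !inE negb_or (disjoint_neq dI ij) //.
  by rewrite (disjoint_neq dI ik) // (disjoint_neq dI jk).
Qed.

Lemma t1_cab_morphism n p (I : 'I_n -> {set 'I_p}) :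
  partition_family I -> is_lie_morphism (t1_cab I).
Proof. move=> pI; apply: pres_lift_morphism => s t; exact: t1_cab_rel. Qed.

(** [f2_ins p I J K psi] is [psi^(I,J,K)] in [t_p]. *)
Definition f2_ins p (I J K : seq nat) (psi : f2) : t_alg p :=
  t_cab (blocks [:: I; J; K]) (f2_to_t3 psi).
Arguments f2_ins p%_N (I J K)%_N psi.

Definition f2_der (a b : f2) : f2 -> f2 :=
  pres_der (fun g : bool => if g then a else b).

Lemma f2_der_derivation a b : is_derivation (f2_der a b).
Proof. exact: pres_der_derivation. Qed.

Lemma f2_derA a b : f2_der a b f2A = a.
Proof. exact: pres_der_gen. Qed.

Lemma f2_derB a b : f2_der a b f2B = b.
Proof. exact: pres_der_gen. Qed.

Definition D_grt (psi : f2) : f2 -> f2 := f2_der [lie psi, f2A] 0.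

Definition grt_bracket (psi1 psi2 : f2) : f2 :=
  [lie psi1, psi2] + D_grt psi2 psi1 - D_grt psi1 psi2.

Definition t3g (i j : nat) : t_alg 3 := tg (inord i.-1) (inord j.-1).

Definition grt1 : set f2 := [set psi |
  [/\ f2_to_t3 psi + f2_ins 3 [:: 3] [:: 2] [:: 1] psi = 0,
      f2_to_t3 psi + f2_ins 3 [:: 2] [:: 3] [:: 1] psi
        + f2_ins 3 [:: 3] [:: 1] [:: 2] psi = 0,
      [lie t3g 2 3, f2_ins 3 [:: 1] [:: 2] [:: 3] psi]
        + [lie t3g 1 3, f2_ins 3 [:: 2] [:: 1] [:: 3] psi] = 0
    & f2_ins 4 [:: 2] [:: 3] [:: 4] psi - f2_ins 4 [:: 1; 2] [:: 3] [:: 4] psi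
        + f2_ins 4 [:: 1] [:: 2; 3] [:: 4] psi
        - f2_ins 4 [:: 1] [:: 2] [:: 3; 4] psi
        + f2_ins 4 [:: 1] [:: 2] [:: 3] psi = 0]]%classic.

Definition t12 : Type := t1_alg 2.
HB.instance Definition _ := LieAlg.on t12.
Definition t13 : Type := t1_alg 3.
HB.instance Definition _ := LieAlg.on t13.

Definition x1 : t12 := xg true ord0.
Definition y1 : t12 := xg false ord0.
Definition t12_12 : t12 := t_to_t1 (tg ord0 ord_max).

(** [x3 s k] is [x_k^s] in [t_{1,3}], for [k] = 1, 2, 3. *)
Definition x3 (s : bool) (k : nat) : t13 := xg s (inord k.-1).

Definition ell_ins (I J : seq nat) (a : t12) : t13 :=
  t1_cab (blocks [:: I; J]) a.
Arguments ell_ins (I J)%_N a.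

Definition psi_ins (I J K : seq nat) (psi : f2) : t13 :=
  t_to_t1 (f2_ins 3 I J K psi).
Arguments psi_ins (I J K)%_N psi.

(** The components [alpha_+] and [alpha_-] of a pair. *)
Definition pm (a : t12 * t12) (s : bool) : t12 := if s then a.1 else a.2.

(** The derivation [x_1^+ |-> alpha_+], [x_1^- |-> alpha_-]; the values on the
    remaining generators are forced by [x_2^s = - x_1^s]. *)
Definition D_ell (a : t12 * t12) : t12 -> t12 :=
  pres_der (fun si : bool * 'I_2 =>
    if si.2 == ord0 then pm a si.1 else - pm a si.1).

Lemma xg2 s i : xg s i = (if i == ord0 then 1 else -1) *: (xg s ord0 : t12).
Proof.
case: eqVneq => [->|i0]; first by rewrite scale1r.
have := xg_sum 2 s; rewrite (bigD1 ord0) //= (bigD1 i) //= big1 ?addr0.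
  by move=> /eqP; rewrite addr_eq0 => /eqP ->; rewrite scaleN1r opprK.
by move=> [[|[|//]] hj] /andP[/eqP j0 /eqP ji]; move: i0 ji j0;
  case: i => [[|[|//]] hi] // _ ji j0; [case: j0 | case: ji]; apply: val_inj.
Qed.

Lemma D_ell_rel a s t : t1_rel s t ->
  let f := fun si : bool * 'I_2 =>
    if si.2 == ord0 then pm a si.1 else - pm a si.1 : t12 in
  lie_der_eval f s = lie_der_eval f t.
Proof.
have piE (e : bool) (i : 'I_2) :
  \pi_(presented (@t1_rel 2)) (LGen (e, i)) = xg e i by [].
have fE (v : t12) (i : 'I_2) : (if i == ord0 then v else - v)
  = (if i == ord0 then 1 else -1) *: v.
  by case: ifP; rewrite ?scale1r ?scaleN1r.
case=> [e|e i j ij|i j ij|e i j k].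
- by move=> f; rewrite lie_der_eval_sum big_ord_recl big_ord1 /= addrN.
- rewrite /= !piE !fE (xg2 _ i) (xg2 _ j).
  rewrite !bracketZl !bracketZr -!scalerDr [X in _ + X]bracketC addrN.
  by rewrite !scaler0.
- rewrite /= !piE !fE (xg2 true i) (xg2 false i) (xg2 true j) (xg2 false j).
  rewrite !bracketZl !bracketZr -!scalerDr !scalerA.
  by rewrite [in LHS]mulrC.
- move=> /card_uniqP; have /= := max_card (mem [:: i; j; k]).
  by rewrite card_ord => + h; rewrite h.
Qed.

Lemma D_ell_derivation a : is_derivation (D_ell a).
Proof. exact/pres_der_derivation/D_ell_rel. Qed.

Lemma D_ell_gen a s : D_ell a (xg s ord0) = pm a s.
Proof. by rewrite /D_ell /xg pres_der_gen //; apply: D_ell_rel. Qed.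

Lemma D_ell_x a : D_ell a x1 = a.1. Proof. exact: D_ell_gen. Qed.
Lemma D_ell_y a : D_ell a y1 = a.2. Proof. exact: D_ell_gen. Qed.

Definition grt1_ell : set (f2 * (t12 * t12)) := [set g |
  let psi := g.1 in let alpha := pm g.2 in
  [/\ grt1 psi,
      forall s, ell_ins [:: 1] [:: 2; 3] (alpha s)
        + ell_ins [:: 2] [:: 3; 1] (alpha s)
        + ell_ins [:: 3] [:: 1; 2] (alpha s)
        + [lie x3 s 1, psi_ins [:: 1] [:: 2] [:: 3] psi]
        + [lie x3 s 2, psi_ins [:: 2] [:: 1] [:: 3] psi] = 0,
      forall s, [lie x3 s 1, ell_ins [:: 3] [:: 1; 2] (alpha s)]
        + [lie ell_ins [:: 1] [:: 2; 3] (alpha s), x3 s 3]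
        - [lie x3 s 1, [lie x3 s 3, psi_ins [:: 1] [:: 2] [:: 3] psi]] = 0
    & [lie x3 true 1, ell_ins [:: 2] [:: 1; 3] (alpha false)]
        - [lie x3 false 2, ell_ins [:: 1] [:: 2; 3] (alpha true)]
      = [lie x3 false 2, [lie x3 true 1, psi_ins [:: 1] [:: 2] [:: 3] psi]]
        - [lie x3 true 1,
             [lie x3 false 2, psi_ins [:: 2] [:: 1] [:: 3] psi]]]]%classic.

Definition grt1_ell_bracket (g h : f2 * (t12 * t12)) : f2 * (t12 * t12) :=
  (grt_bracket g.1 h.1,
   (D_ell h.2 g.2.1 - D_ell g.2 h.2.1, D_ell h.2 g.2.2 - D_ell g.2 h.2.2)).

(** The derivations of [f2] and [t12] which multiply homogeneous elements by
    [deg] and [deg_-] respectively, see [f2_degE] and [t12_degmE]. *)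
Definition f2_deg : f2 -> f2 := f2_der f2A f2B.
Definition t12_degm : t12 -> t12 := D_ell (0, y1).

Definition ad_e22 (g : f2 * (t12 * t12)) : f2 * (t12 * t12) :=
  (- f2_deg g.1, (- t12_degm g.2.1, g.2.2 - t12_degm g.2.2)).

(** The element [(g, c)] stands for [g + c e_22]. *)
Definition grt_ell : set (f2 * (t12 * t12) * rat) :=
  [set u | grt1_ell u.1]%classic.

Definition grt_ell_bracket (u v : f2 * (t12 * t12) * rat) :
    f2 * (t12 * t12) * rat :=
  let: (g, c) := u in let: (h, d) := v in
  let: (g', h') := (ad_e22 g, ad_e22 h) in
  ((grt1_ell_bracket g h).1 + c *: h'.1 - d *: g'.1,
   ((grt1_ell_bracket g h).2.1 + c *: h'.2.1 - d *: g'.2.1,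
    (grt1_ell_bracket g h).2.2 + c *: h'.2.2 - d *: g'.2.2), 0).

Definition e22 : f2 * (t12 * t12) * rat := (0, 1).

(** The identification of [(alpha_+, alpha_-)] with [(0, alpha_+, alpha_-)]. *)
Definition r_incl (a : t12 * t12) : f2 * (t12 * t12) * rat := ((0, a), 0).

Definition grt_ell_to_grt (u : f2 * (t12 * t12) * rat) : f2 * rat :=
  (u.1.1, u.2).

Definition r_ell_gr : set (t12 * t12) := [set a |
  [/\ forall s, ell_ins [:: 1] [:: 2; 3] (pm a s)
        + ell_ins [:: 2] [:: 3; 1] (pm a s)
        + ell_ins [:: 3] [:: 1; 2] (pm a s) = 0,
      forall s, [lie x3 s 1, ell_ins [:: 2] [:: 1; 3] (pm a s)]
        + [lie ell_ins [:: 1] [:: 2; 3] (pm a s), x3 s 2] = 0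
    & [lie x3 true 1, ell_ins [:: 2] [:: 1; 3] (pm a false)]
        + [lie ell_ins [:: 1] [:: 2; 3] (pm a true), x3 false 2] = 0]]%classic.

Inductive t12_bideg : int -> int -> t12 -> Prop :=
| BD_x : t12_bideg 1 0 x1
| BD_y : t12_bideg 0 1 y1
| BD_0 p q : t12_bideg p q 0
| BD_add p q u v : t12_bideg p q u -> t12_bideg p q v -> t12_bideg p q (u + v)
| BD_scale p q (c : rat) u : t12_bideg p q u -> t12_bideg p q (c *: u)
| BD_br p q p' q' u v : t12_bideg p q u -> t12_bideg p' q' v ->
    t12_bideg (p + p') (q + q') [lie u, v].

Definition r_ell_gr_bideg (p q : int) : set (t12 * t12) := [set a |
  r_ell_gr a /\ forall k l u, t12_bideg k l u ->
    t12_bideg (k + p) (l + q) (D_ell a u)]%classic.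

Definition delta (n : nat) : t12 * t12 :=
  (iter (2 * n + 2) (ad x1) y1,
   2^-1 *: \sum_(p < 2 * n + 2)
     (-1) ^+ p *: [lie iter p (ad x1) y1, iter (2 * n + 1 - p) (ad x1) y1]).

Inductive f2_homog : nat -> f2 -> Prop :=
| HF_A : f2_homog 1 f2A
| HF_B : f2_homog 1 f2B
| HF_0 p : f2_homog p 0
| HF_add p u v : f2_homog p u -> f2_homog p v -> f2_homog p (u + v)
| HF_scale p (c : rat) u : f2_homog p u -> f2_homog p (c *: u)
| HF_br p q u v : f2_homog p u -> f2_homog q v -> f2_homog (p + q) [lie u, v].

Lemma is_derivation0 (L : lieAlgType) (D : L -> L) : is_derivation D -> D 0 = 0.
Proof. by case=> _ DZ _; rewrite -[X in D X](scale0r (0 : L)) DZ scale0r. Qed.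

Lemma f2_degE p u : f2_homog p u -> f2_deg u = p%:R *: u.
Proof.
have dD := f2_der_derivation f2A f2B; have [DD DZ DB] := dD.
elim=> {p u} [|||p u v _ hu _ hv|p c u _ hu|p q u v _ hu _ hv].
- by rewrite /f2_deg f2_derA scale1r.
- by rewrite /f2_deg f2_derB scale1r.
- by move=> p; rewrite scaler0 [LHS](is_derivation0 dD).
- by rewrite scalerDr -hu -hv [LHS]DD.
- by rewrite scalerA mulrC -scalerA -hu [LHS]DZ.
- by rewrite natrD scalerDl -bracketZl -bracketZr -hu -hv [LHS]DB.
Qed.

Lemma t12_degmE p q u : t12_bideg p q u -> t12_degm u = q%:~R *: u.
Proof.
have dD := D_ell_derivation (0, y1); have [DD DZ DB] := dD.
elim=> {p q u} [||p q|p q u v _ hu _ hv|p q c u _ hu|p q p' q' u v _ hu _ hv].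
- by rewrite /t12_degm D_ell_x scale0r.
- by rewrite /t12_degm D_ell_y scale1r.
- by rewrite scaler0 [LHS](is_derivation0 dD).
- by rewrite scalerDr -hu -hv [LHS]DD.
- by rewrite scalerA mulrC -scalerA -hu [LHS]DZ.
- by rewrite intrD scalerDl -bracketZl -bracketZr -hu -hv [LHS]DB.
Qed.

Definition blocks_count n (l : seq (seq nat)) (a : nat) : nat :=
  count (fun i => a.+1 \in nth [::] l i) (iota 0 n).

Lemma blocks_disjoint n p l :
  all (fun a => blocks_count n l a <= 1)%N (iota 0 p) ->
  disjoint_family (@blocks n p l).
Proof.
move=> /allP h i j ij; apply/pred0P => a /=; rewrite !inE.
apply/negP => /andP[ai aj].
have := h a; rewrite mem_iota /= add0n ltn_ord => /(_ isT).
rewrite leqNgt => /negP; apply; rewrite /blocks_count -size_filter.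
apply: (uniq_leq_size (s1 := [:: val i; val j])).
  by rewrite /= inE andbT.
by move=> k; rewrite !inE mem_filter mem_iota => /orP[] /eqP ->;
  rewrite ?ai ?aj /= add0n ltn_ord.
Qed.

Lemma blocks_partition n p l :
  all (fun a => blocks_count n l a == 1)%N (iota 0 p) ->
  partition_family (@blocks n p l).
Proof.
move=> /allP h; split.
  by apply: blocks_disjoint; apply/allP => a /h /eqP ->.
move=> a; have := h a; rewrite mem_iota /= add0n ltn_ord => /(_ isT) /eqP e.
have /hasP[i] : has (fun i => a.+1 \in nth [::] l i) (iota 0 n).
  by rewrite has_count -/(blocks_count n l a) e.
by rewrite mem_iota /= add0n => hi ai; exists (Ordinal hi); rewrite inE.
Qed.

Lemma lie_morphism0 (L M : lieAlgType) (f : L -> M) :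
  is_lie_morphism f -> f 0 = 0.
Proof. by case=> _ fZ _; rewrite -[X in f X](scale0r (0 : L)) fZ scale0r. Qed.

Lemma lie_morphismB (L M : lieAlgType) (f : L -> M) u v :
  is_lie_morphism f -> f (u - v) = f u - f v.
Proof. by case=> fD fZ _; rewrite fD -scaleN1r fZ scaleN1r. Qed.

Lemma pres_morphism_ext X R (L : lieAlgType) (f g : @presented X R -> L) :
  is_lie_morphism f -> is_lie_morphism g ->
  (forall x, f (pres_gen R x) = g (pres_gen R x)) -> f =1 g.
Proof.
move=> hf hg fg; elim/quotW.
have [fD fZ fB] := hf; have [gD gZ gB] := hg.
elim=> [x||s hs t ht|c s hs|s hs t ht].
- exact: fg.
- by rewrite [LHS](lie_morphism0 hf) [RHS](lie_morphism0 hg).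
- by rewrite pres_piD fD gD hs ht.
- by rewrite pres_piZ fZ gZ hs.
- by rewrite pres_pi_br fB gB hs ht.
Qed.

Lemma t1_cab_gen n p (I : 'I_n -> {set 'I_p}) s i :
  partition_family I -> t1_cab I (xg s i) = \sum_(a in I i) xg s a.
Proof. by move=> pI; apply: pres_lift_gen => *; apply: t1_cab_rel. Qed.

Lemma ell_ins_morphism I J :
  all (fun a => blocks_count 2 [:: I; J] a == 1)%N (iota 0 3) ->
  is_lie_morphism (ell_ins I J).
Proof. by move=> h; apply/t1_cab_morphism/blocks_partition. Qed.

Lemma f2_ins_morphism p I J K :
  all (fun a => blocks_count 3 [:: I; J; K] a <= 1)%N (iota 0 p) ->
  is_lie_morphism (f2_ins p I J K).
Proof.
move=> h; have [cD cZ cB] := t_cab_morphism (blocks_disjoint h).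
have [iD iZ iB] := f2_to_t3_morphism.
by split=> *; rewrite /f2_ins ?(iD, iZ, iB) ?(cD, cZ, cB).
Qed.

Lemma grt1_0 : grt1 0.
Proof.
have z p I J K : all (fun a => blocks_count 3 [:: I; J; K] a <= 1)%N (iota 0 p)
    -> f2_ins p I J K 0 = 0.
  by move=> h; apply/lie_morphism0/f2_ins_morphism.
by split; rewrite ?(lie_morphism0 f2_to_t3_morphism) !z // ?bracket0r
  ?subr0 ?addr0.
Qed.

Lemma psi_ins0 I J K :
  all (fun a => blocks_count 3 [:: I; J; K] a <= 1)%N (iota 0 3) ->
  psi_ins I J K 0 = 0.
Proof.
move=> h; rewrite /psi_ins (lie_morphism0 (f2_ins_morphism h)).
exact: (lie_morphism0 (@t_to_t1_morphism 3)).
Qed.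

Definition swap23 : t13 -> t13 := t1_cab (blocks [:: [:: 1]; [:: 3]; [:: 2]]).

Lemma swap23_morphism : is_lie_morphism swap23.
Proof. exact/t1_cab_morphism/blocks_partition. Qed.

Lemma sum_blocks n l (i : 'I_n) s :
  \sum_(a in blocks l i) (xg s a : t13) =
    \sum_(k <- [:: 1; 2; 3]%N | k \in nth [::] l i) x3 s k.
Proof.
rewrite big_mkcond /= !big_ord_recl big_ord0 !inE /= !big_cons big_nil /=.
have e k (h : (k < 3)%N) : inord k = Ordinal h by apply/val_inj/inordK.
rewrite /x3 /= (e 0%N isT) (e 1%N isT) (e 2 isT).
have -> : ord0 = Ordinal (isT : (0 < 3)%N) by apply: val_inj.
have -> : lift (Ordinal (isT : (0 < 3)%N)) ord0 = Ordinal (isT : (1 < 3)%N).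
  exact: val_inj.
set b := lift _ (lift _ _).
have -> : b = Ordinal (isT : (2 < 3)%N) by apply: val_inj.
by rewrite /bump /=; case: ifP; case: ifP; case: ifP; rewrite ?add0r ?addr0.
Qed.

Lemma swap23_x3 s k : k \in [:: 1; 2; 3]%N ->
  swap23 (x3 s k) = x3 s (nth 0 [:: 0; 1; 3; 2] k)%N.
Proof.
move=> hk; rewrite /swap23 /x3 t1_cab_gen; last exact: blocks_partition.
rewrite sum_blocks !big_cons big_nil.
by move: hk; rewrite !inE => /or3P[] /eqP ->; rewrite inordK //= ?addr0.
Qed.

Lemma swap23_ell I J I' J' (a : t12) :
  all (fun a => blocks_count 2 [:: I; J] a == 1)%N (iota 0 3) ->
  all (fun a => blocks_count 2 [:: I'; J'] a == 1)%N (iota 0 3) ->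
  all (fun k => ((nth 0%N [:: 0; 1; 3; 2]%N k \in I) == (k \in I'))
     && ((nth 0%N [:: 0; 1; 3; 2]%N k \in J) == (k \in J'))) [:: 1; 2; 3]%N ->
  swap23 (ell_ins I J a) = ell_ins I' J' a.
Proof.
move=> h h' hh; have [fD fZ fB] := ell_ins_morphism h.
have [gD gZ gB] := swap23_morphism.
apply: (pres_morphism_ext (f := fun a => swap23 (ell_ins I J a))) a.
- by split=> *; rewrite ?(fD, fZ, fB) ?(gD, gZ, gB).
- exact: ell_ins_morphism h'.
case=> s i; rewrite -/(xg s i) /ell_ins !t1_cab_gen; try exact: blocks_partition.
rewrite !sum_blocks !big_cons !big_nil.
move: hh => /=; case: i => [[|[|//]] hi] /=.
  move=> /and4P[/andP[/eqP <- _] /andP[/eqP <- _] /andP[/eqP <- _] _].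
  do 3!case: ifP => _; rewrite ?gD ?(lie_morphism0 swap23_morphism)
    ?swap23_x3 //= ?addr0 //; first [by rewrite addrC
      | by congr (_ + _); rewrite addrC].
move=> /and4P[/andP[_ /eqP <-] /andP[_ /eqP <-] /andP[_ /eqP <-] _].
do 3!case: ifP => _; rewrite ?gD ?(lie_morphism0 swap23_morphism)
  ?swap23_x3 //= ?addr0 //; first [by rewrite addrC
    | by congr (_ + _); rewrite addrC].
Qed.

Lemma ker_grt_ell_to_grt :
  ([set u | grt_ell u /\ grt_ell_to_grt u = 0] =
   [set r_incl a | a in r_ell_gr])%classic.
Proof.
have mor := swap23_morphism; have [sD sZ sB] := mor; have s0 := lie_morphism0 mor.
have E1 (a : t12) : swap23 (ell_ins [:: 1] [:: 2; 3] a) = ell_ins [:: 1] [:: 2; 3] a.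
  exact: swap23_ell.
have E2 (a : t12) : swap23 (ell_ins [:: 2] [:: 1; 3] a) = ell_ins [:: 3] [:: 1; 2] a.
  exact: swap23_ell.
have E3 (a : t12) : swap23 (ell_ins [:: 3] [:: 1; 2] a) = ell_ins [:: 2] [:: 1; 3] a.
  exact: swap23_ell.
have second (a : t12) s :
  [lie x3 s 1, ell_ins [:: 3] [:: 1; 2] a]
    + [lie ell_ins [:: 1] [:: 2; 3] a, x3 s 3] = 0 <->
  [lie x3 s 1, ell_ins [:: 2] [:: 1; 3] a]
    + [lie ell_ins [:: 1] [:: 2; 3] a, x3 s 2] = 0.
  by split=> /(congr1 swap23); rewrite s0 sD !sB !swap23_x3 // E1 ?E2 ?E3.
apply/seteqP; split=> [[[psi a] c] [] |_ [a [h1 h2 h3] <-]].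
  rewrite /grt_ell /= => -[_ h1 h2 h3] [p0 c0]; move: h1 h2 h3.
  rewrite /= {psi}p0 {c}c0 => h1 h2 h3; exists a => //; split.
  - by move=> s; have := h1 s; rewrite !psi_ins0 // !bracket0r !addr0.
  - by move=> s; have := h2 s; rewrite !psi_ins0 // !bracket0r subr0 => /second.
  - by move: h3; rewrite !psi_ins0 // !bracket0r subr0 [in X in X -> _]bracketC
      [X in _ - X]bracketC opprK => <-; rewrite [X in X + _]bracketC.
split=> //; split=> [|s|s|] /=.
- exact: grt1_0.
- by rewrite !psi_ins0 // !bracket0r !addr0.
- by rewrite !psi_ins0 // !bracket0r subr0; apply/second.
- rewrite !psi_ins0 // !bracket0r subr0 -h3; congr (_ + _).
  by rewrite [RHS]bracketC.
Qed.

(* Main.v *)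
Require Import Defs.
From mathcomp Require Import all_boot all_order all_algebra.
From mathcomp Require Import boolp classical_sets zify.

Set Implicit Arguments.
Unset Strict Implicit.
Unset Printing Implicit Defensive.

Import GRing.Theory.
Local Open Scope ring_scope.

(** Write [t_ij = [x_i, y_j]] and [A^ij_p = (ad x_i)^p t_ij] in [t_{1,3}]; then
    [A^ji_p = (-1)^p A^ij_p] and [x_k] kills [A^ij_p].  With
    [T = A^12_2n + A^23_2n + A^31_2n] and
    [beta_ij = - 1/2 sum_(p+q=2n-1) (-1)^p [A^ij_p, A^ij_q]], the images of
    [delta_2n] at the strand [i] are [alpha_+ = [T, x_i]] and
    [alpha_- = [T, y_i] + beta_ij + beta_ik].  The inner part contributes nothing
    to the relations of [r_ell^gr] but the term [[T, t_12]], which equals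
    [[x_1, beta_12]] because the alternating sum telescopes.  What remains is
    [[y_3, beta_12] + [y_1, beta_23] + [y_2, beta_31] = 0], a sum of Jacobi
    identities for triples [A^12_a, A^23_b, A^31_c], [a + b + c = 2n - 2].

    For centrality, [delta_0] acts as [ad t_12], so one needs
    [D_alpha(t_12) = 0] for [(psi, alpha)] in [grt_1^ell].  Forgetting the third
    strand maps [psi] to an element commuting with [t_12], turns the first
    relation into [alpha(-x, -y) = - alpha(x, y)], and then the third one into
    [D_alpha [x_1, y_1] = 0]. *)

(** * Sums over triples of indices with a fixed total *)

Section TriangularSum.
Variables (V : zmodType) (F : nat -> nat -> nat -> V).

(** The three indices of [F] add up to m - 2; the nested form is the one in which [y_beta] produces
    the sum. *)
Definition trisum m : V :=
  \sum_(p < m) \sum_(a < p) F a (p.-1 - a)%N (m.-1 - p)%N.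

(** Makes the symmetry in the indices visible: a rotation becomes an exchange of summations. *)
Lemma trisumE m : trisum m =
  \sum_(a < m) \sum_(b < m) \sum_(c < m)
    if (a + b + c + 2 == m)%N then F a b c else 0.
Proof.
transitivity (\sum_(p < m) \sum_(a < m) \sum_(b < m)
    if ((a + b).+1 == p)%N then F a b (m.-1 - p)%N else 0).
  apply: eq_bigr => p _; rewrite (big_ord_widen _
    (fun a => F a (p.-1 - a)%N (m.-1 - p)%N)
    (ltnW (ltn_ord p))) big_mkcond; apply: eq_bigr => a _.
  rewrite -big_mkcond; have pm := ltn_ord p; case: ltnP => ap.
    have bm : (p.-1 - a < m)%N by lia.
    rewrite (big_pred1 (Ordinal bm)) // => b.
    by rewrite /= -val_eqE /=; lia.
  by rewrite big_pred0 // => b; lia.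
rewrite exchange_big; apply: eq_bigr => a _.
rewrite exchange_big; apply: eq_bigr => b _ /=.
rewrite (reindex_inj rev_ord_inj); apply: eq_bigr => c _ /=.
have cm := ltn_ord c; rewrite (_ : (m.-1 - (m - c.+1))%N = c); last by lia.
by rewrite (_ : ((a + b).+1 == m - c.+1)%N = (a + b + c + 2 == m)%N) //; lia.
Qed.

End TriangularSum.

Lemma trisum_rot (V : zmodType) (F : nat -> nat -> nat -> V) m :
  trisum F m = trisum (fun a b c => F b c a) m.
Proof.
rewrite !trisumE [RHS]exchange_big; apply: eq_bigr => a _ /=.
rewrite [RHS]exchange_big; apply: eq_bigr => b _ /=.
by apply: eq_bigr => c _; rewrite -[in RHS](addnA c) (addnC c).
Qed.

(** * Alternating sums of brackets in a Lie algebra *)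

Section LieAlgebra.
Variable L : lieAlgType.
Implicit Types (x y z u v : L) (f g : nat -> L) (m n p : nat).

Lemma bracket_der x u v :
  [lie x, [lie u, v]] = [lie [lie x, u], v] + [lie u, [lie x, v]].
Proof.
have := jacobi x u v; rewrite -addrA => /eqP; rewrite addr_eq0 => /eqP ->.
by rewrite opprD addrC [X in - X]bracketC opprK (bracketC v x) bracketNr opprK.
Qed.

(** Separates the inner derivation ad x, which acts on [u, v] as a whole, from the corrections a and
    b; applied with x = T and corrections built from [beta]. *)
Lemma bracket_der_perturb x u v a b :
  [lie u, [lie x, v] + b] + [lie [lie x, u] + a, v]
    = [lie x, [lie u, v]] + ([lie u, b] + [lie a, v]).
Proof.
by rewrite bracketDr bracketDl (bracket_der x) addrACA [X in X + _]addrC.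
Qed.

Lemma ad_derivation x : is_derivation (ad x).
Proof.
by split=> *; rewrite /ad ?bracketDr ?bracketZr // bracket_der.
Qed.

Lemma iter_ad_bracket0 x u v p : [lie x, u] = 0 ->
  iter p (ad x) [lie u, v] = [lie u, iter p (ad x) v].
Proof.
move=> xu; elim: p => //= p ->.
by rewrite [LHS]/ad bracket_der xu bracket0l add0r.
Qed.

Lemma iter_ad_bracketr0 x u v p : [lie x, v] = 0 ->
  iter p (ad x) [lie u, v] = [lie iter p (ad x) u, v].
Proof.
move=> xv; elim: p => //= p ->.
by rewrite [LHS]/ad bracket_der xv bracket0r addr0.
Qed.

Lemma iter_ad_morph (M : lieAlgType) (f : M -> L) p a b :
  is_lie_morphism f -> f (iter p (ad a) b) = iter p (ad (f a)) (f b).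
Proof. by case=> _ _ fB; elim: p => //= p <-; rewrite /ad fB. Qed.

(** The indices add up to m - 1 while m counts the terms, so m = 0 gives the empty sum. *)
Definition altsum f g m : L :=
  \sum_(a < m) (-1) ^+ a *: [lie f a, g (m.-1 - a)%N].

Lemma altsumDl f f' g m :
  altsum (fun a => f a + f' a) g m = altsum f g m + altsum f' g m.
Proof.
by rewrite -big_split; apply: eq_bigr => a _; rewrite bracketDl scalerDr.
Qed.

Lemma altsumDr f g g' m :
  altsum f (fun a => g a + g' a) m = altsum f g m + altsum f g' m.
Proof.
by rewrite -big_split; apply: eq_bigr => a _; rewrite bracketDr scalerDr.
Qed.

(** Reversing the sum costs (-1)^(m-1), antisymmetry of the bracket another -1. *)
Lemma altsumC f g m : altsum f g m = (-1) ^+ m *: altsum g f m.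
Proof.
rewrite /altsum (reindex_inj rev_ord_inj) scaler_sumr; apply: eq_bigr => a _ /=.
case: m a => [[]//|m] a /=; rewrite subSS.
have am : (a <= m)%N by rewrite -ltnS.
rewrite (subKn am) bracketC scalerN scalerA exprS mulN1r mulNr scaleNr.
by congr (- (_ *: _)); rewrite -signr_odd oddB // signr_addb !signr_odd.
Qed.

Lemma altsum_odd f m : odd m -> altsum f f m = 0.
Proof.
move=> om; have := altsumC f f m.
rewrite -signr_odd om scaleN1r => /eqP; rewrite -addr_eq0 -mulr2n -scaler_nat.
by rewrite scaler_eq0 Num.Theory.pnatr_eq0 => /eqP.
Qed.

Definition half_altsum f m : L := 2^-1 *: altsum f f m.

(** By [altsumC] the two halves of the Leibniz rule agree for even m, which absorbs the factor
    1/2. *)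
Lemma half_altsum_der (D : L -> L) f m : is_derivation D -> ~~ odd m ->
  D (half_altsum f m) = altsum (fun a => D (f a)) f m.
Proof.
move=> dD em; have [DD DZ DB] := dD.
rewrite DZ (big_morph D DD (is_derivation0 dD)).
rewrite (eq_bigr (fun a : 'I_m => (-1) ^+ a *: [lie D (f a), f (m.-1 - a)%N]
   + (-1) ^+ a *: [lie f a, D (f (m.-1 - a)%N)])); last first.
  by move=> a _; rewrite DZ DB scalerDr.
rewrite big_split /= -/(altsum (D \o f) f m) -/(altsum f (D \o f) m).
rewrite [X in _ + X]altsumC -signr_odd (negbTE em) scale1r -mulr2n.
by rewrite -scaler_nat scalerA mulVf // scale1r.
Qed.

Lemma half_altsumD f g m : ~~ odd m ->
  half_altsum (fun a => f a + g a) m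
    = half_altsum f m + half_altsum g m + altsum f g m.
Proof.
move=> em; rewrite /half_altsum altsumDl !altsumDr (altsumC g f).
rewrite -signr_odd (negbTE em) scale1r !scalerDr (AC (2*2) ((1*4)*(2*3))).
by congr (_ + _); rewrite -[LHS]mulr2n -scaler_nat scalerA mulfV // scale1r.
Qed.

Lemma half_altsumN f m : half_altsum (fun a => - f a) m = half_altsum f m.
Proof.
by congr (_ *: _); apply: eq_bigr => a _; rewrite bracketNl bracketNr opprK.
Qed.

Lemma half_altsum_morph (M : lieAlgType) (h : L -> M) f m :
  is_lie_morphism h -> h (half_altsum f m) = 2^-1 *: \sum_(a < m)
    (-1) ^+ a *: [lie h (f a), h (f (m.-1 - a)%N)].
Proof.
move=> hm; have [hD hZ hB] := hm; rewrite hZ (big_morph h hD (lie_morphism0 hm)).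
by congr (_ *: _); apply: eq_bigr => a _; rewrite hZ hB.
Qed.

(** The terms at the two ends are equal, so the factor 1/2 leaves one of them; in the middle, the
    shift of the index reverses the signs. *)
Lemma half_altsum_recl_recr f n :
  half_altsum f (2 * n + 2)
    = [lie f 0%N, f (2 * n + 1)%N] - half_altsum (f \o S) (2 * n).
Proof.
rewrite /half_altsum /altsum addn2 addn1 big_ord_recl big_ord_recr /=.
rewrite !expr0 !scale1r subn0 /bump !add1n subnn (bracketC _ (f 0%N)).
rewrite scalerN exprS mulN1r exprM expr2 mulrNN mulr1 expr1n scaleN1r opprK.
rewrite addrCA -mulr2n -scaler_nat scalerDr scalerA mulVf // scale1r addrC.
congr (_ + _); rewrite -scalerN -sumrN; congr (_ *: _); apply: eq_bigr => a _.
rewrite exprS mulN1r scaleNr subSS; congr (- (_ *: [lie _, f _])).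
by case: n a => [[]//|n] a /=; rewrite -subSn // -ltnS; case: a.
Qed.

(** This is the vanishing of [altsum f f (2 * n).+1], with its first term set apart. *)
Lemma altsum_shift f n :
  altsum (f \o S) f (2 * n) = - [lie f (2 * n)%N, f 0%N].
Proof.
have := @altsum_odd f (2 * n).+1; rewrite /= oddM /= => /(_ isT)/eqP.
rewrite /altsum big_ord_recl /= expr0 scale1r subn0.
rewrite addrC addr_eq0 => /eqP h; rewrite bracketC opprK.
rewrite -[RHS]opprK -h -sumrN; apply: eq_bigr => a _.
rewrite /bump add1n exprS mulN1r scaleNr opprK.
by case: n {h} a => [[]//|n] a.
Qed.

End LieAlgebra.

Lemma t_to_t1_tg n (i j : 'I_n) :
  t_to_t1 (tg i j) = if i == j then 0 else [lie xg true i, xg false j].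
Proof. by rewrite [LHS]pres_lift_gen //; apply: t_to_t1_rel. Qed.

(** * The elements A^ij_p of t_{1,3} and their brackets with the generators *)

Section ThreeStrands.
Implicit Types (i j k : 'I_3) (s : bool) (n p : nat).

Lemma uniq3_rot i j k : uniq [:: i; j; k] -> uniq [:: j; k; i].
Proof. by rewrite -(rot_uniq 1). Qed.

Lemma uniq3_swap i j k : uniq [:: i; j; k] -> uniq [:: j; i; k].
Proof.
by apply: etrans; apply/perm_uniq/seq.permP => a /=; rewrite addnCA.
Qed.

Lemma uniq3_neq i j k : uniq [:: i; j; k] -> i != j.
Proof. by rewrite /= !inE negb_or => /andP[/andP[]]. Qed.

Lemma xg3_sum s i j k : uniq [:: i; j; k] ->
  xg s i + xg s j + xg s k = 0 :> t13.
Proof.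
move=> u; have eI : index_enum 'I_3 = enum 'I_3 by rewrite enumT.
have [||_ e] := uniq_min_size (s2 := index_enum 'I_3) u.
- by move=> a _; rewrite mem_index_enum.
- by rewrite eI size_enum_ord.
rewrite -[RHS](xg_sum 3 s) -(perm_big _ (uniq_perm u (index_enum_uniq _) e)).
by rewrite /= !big_cons big_nil addr0 addrA.
Qed.

Definition tij i j : t13 := [lie xg true i, xg false j].

Definition ad_t i j p : t13 := iter p (ad (xg true i)) (tij i j).

Lemma tijC i j : i != j -> tij i j = tij j i.
Proof. exact: xg_sym. Qed.

Lemma xg_tij s i j k : uniq [:: i; j; k] -> [lie xg s k, tij i j] = 0.
Proof. exact: xg_br3. Qed.

(** Image of the relation [t_jk, t_ji + t_ki] = 0 of t_3. *)
Lemma tij_cycle i j k : uniq [:: i; j; k] ->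
  [lie tij i j, tij j k] = [lie tij j k, tij k i].
Proof.
move=> u; have u2 := uniq3_rot u.
have := congr1 (@t_to_t1 3) (tg_br3 u2).
have mor := t_to_t1_morphism 3; have [mD _ mB] := mor.
rewrite (lie_morphism0 mor) mB mD !t_to_t1_tg.
move: u; rewrite /= !inE andbT negb_or => /andP[/andP[ij ik] jk].
rewrite [j == i]eq_sym [k == i]eq_sym (negbTE ij) (negbTE ik) (negbTE jk).
rewrite -/(tij j k) -/(tij j i) -/(tij k i) bracketDr => /eqP.
by rewrite addrC addr_eq0 => /eqP ->; rewrite bracketC (tijC ij).
Qed.

Lemma ad_t_kill i j k p : uniq [:: i; j; k] -> [lie xg true k, ad_t i j p] = 0.
Proof.
move=> u; elim: p => [|p IH]; first exact: xg_tij.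
by rewrite /= bracket_comm // xg_comm.
Qed.

(** Here x_j = - x_i - x_k, and x_k kills A^ij_p. *)
Lemma ad_tS i j k p : uniq [:: i; j; k] ->
  [lie xg true j, ad_t i j p] = - ad_t i j p.+1.
Proof.
move=> u; apply/eqP; rewrite -addr_eq0 addrC -bracketDl.
by have /eqP := xg3_sum true u; rewrite addr_eq0 => /eqP ->;
  rewrite bracketNl ad_t_kill ?oppr0.
Qed.

Lemma ad_tC i j k p : uniq [:: i; j; k] ->
  ad_t j i p = (-1) ^+ p *: ad_t i j p.
Proof.
move=> u; have ij := uniq3_neq u.
elim: p => [|p IH]; first by rewrite scale1r /ad_t /= (tijC ij).
rewrite [LHS]/= -/(ad_t j i p) IH /ad bracketZr (ad_tS p u).
by rewrite scalerN exprS mulN1r scaleNr.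
Qed.

(** From y_i = - y_j - y_k; the first application of ad x_i turns y_j and y_k into t_ij and t_ik,
    whence the shift of the index. *)
Lemma iter_ad_yE i j k p : uniq [:: i; j; k] ->
  iter p.+1 (ad (xg true i)) (xg false i) = - (ad_t i j p + ad_t i k p).
Proof.
move=> u; elim: p => [|p IH].
  have /eqP := xg3_sum false u; rewrite -addrA addr_eq0 => /eqP /= {1}->.
  by rewrite /ad bracketNr bracketDr.
by rewrite iterS IH /ad bracketNr bracketDr.
Qed.

(* Both sides of the induction step are translates of [t_jk, t_ki] = [t_ki, t_ij]. *)
Lemma y_ad_t i j k p : uniq [:: i; j; k] ->
  [lie xg false k, ad_t i j p]
    = (-1) ^+ p *: \sum_(a < p) [lie ad_t j k a, ad_t k i (p.-1 - a)%N].
Proof.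
move=> u; have u2 := uniq3_rot u; have u3 := uniq3_rot u2.
have ki := uniq3_neq u3; have ij := uniq3_neq u.
elim: p => [|p IH]; first by rewrite big_ord0 scaler0; apply: xg_tij.
(* By Leibniz, [x_i, [y_k, A^ij_p]] gives the terms a < p of the new sum and [[y_k, x_i], A^ij_p]
   the term a = p. *)
rewrite [in LHS]/ad_t iterS -/(ad_t i j p) {1}/ad bracket_der IH.
rewrite big_ord_recr /= subnn scalerDr addrC; congr (_ + _).
  rewrite bracketZr exprS mulN1r scaleNr -scalerN -sumrN bracket_sumr.
  congr (_ *: _); apply: eq_bigr => a _.
  rewrite bracket_der (ad_t_kill _ u2) bracket0l add0r (ad_tS _ u3) bracketNr.
  by case: p {IH} a => [[]//|p] a; rewrite -subSn // -ltnS.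
(* Once A^ij_p is written with ad x_j, which kills t_ki, both brackets are (ad x_j)^p of
   [t_ki, t_ij] = [t_jk, t_ki]. *)
rewrite [X in bracket X _]bracketC -/(tij i k) -(tijC ki) -[j in ad_t i j]/j.
rewrite (ad_tC p (uniq3_swap u)) bracketZr bracketNl scalerN.
rewrite exprS mulN1r scaleNr; congr (- (_ *: _)).
rewrite -iter_ad_bracket0 ?(xg_tij _ u3) // -(tijC ij) (tij_cycle u3).
by rewrite (tij_cycle u) iter_ad_bracketr0 ?(xg_tij _ u3).
Qed.

Definition ad_t_sum i j k n : t13 :=
  ad_t i j (2 * n) + ad_t j k (2 * n) + ad_t k i (2 * n).

Lemma ad_t_evenC i j k n : uniq [:: i; j; k] ->
  ad_t j i (2 * n) = ad_t i j (2 * n).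
Proof.
by move=> u; rewrite (ad_tC _ u) exprM expr2 mulrNN mulr1 expr1n scale1r. Qed.

Lemma ad_t_sum_rot i j k n : ad_t_sum j k i n = ad_t_sum i j k n.
Proof. by rewrite /ad_t_sum [LHS]addrC addrA. Qed.

Lemma ad_t_sum_x i j k n : uniq [:: i; j; k] ->
  [lie ad_t_sum i j k n, xg true i]
    = iter (2 * n + 2) (ad (xg true i)) (xg false i).
Proof.
move=> u; have u2 := uniq3_rot u; have u3 := uniq3_rot u2.
rewrite addn2 (iter_ad_yE _ u) [LHS]bracketC; congr (- _).
rewrite /ad_t_sum (ad_t_evenC n (uniq3_swap u3)) !bracketDr.
by rewrite (ad_t_kill _ u2) addr0.
Qed.

(* Only [ad_t i j (2 * n)] contributes: the two other terms add up to
   [(ad x_k)^(2n) (t_ki + t_kj)]. *)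
Lemma ad_t_sum_t i j k n : uniq [:: i; j; k] ->
  [lie ad_t_sum i j k n, tij i j] = [lie ad_t i j (2 * n), tij i j].
Proof.
move=> u; have u2 := uniq3_rot u; have u3 := uniq3_rot u2.
rewrite /ad_t_sum -(ad_t_evenC n u2) -addrA bracketDl -[RHS]addr0.
have xt := xg_tij true u; congr (_ + _); rewrite bracketDl.
(* Since x_k kills t_ij, (ad x_k)^(2n) comes out of both brackets; what remains is opposite by
   [tij_cycle]. *)
rewrite -(iter_ad_bracketr0 (tij k j) _ xt) -(iter_ad_bracketr0 (tij k i) _ xt).
rewrite -(tijC (uniq3_neq u2)) (bracketC (tij j k)) (tij_cycle u3).
have -> v : iter (2 * n) (ad (xg true k)) (- v) =
    - iter (2 * n) (ad (xg true k)) v.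
  by elim: (2 * n)%N => //= m ->; rewrite /ad bracketNr.
by rewrite addNr.
Qed.

(** * The corrections beta_ij and the relations satisfied by the images of delta_2n *)

Definition beta i j n : t13 := - half_altsum (ad_t i j) (2 * n).

(** The two indices in each term add up to the odd number 2n - 1, so the signs of [ad_tC] multiply
    to -1. *)
Lemma betaC i j k n : uniq [:: i; j; k] -> beta j i n = - beta i j n.
Proof.
move=> u; congr (- _); rewrite /beta /half_altsum -scalerN; congr (_ *: _).
rewrite -sumrN; apply: eq_bigr => a _; rewrite !(ad_tC _ u).
rewrite bracketZl bracketZr !scalerA -scaleNr; congr (_ *: _).
rewrite -exprD subnKC; last by case: n a => [[]//|n] a; rewrite -ltnS.
case: n a => [[]//|n] a.
suff -> : (-1) ^+ (2 * n.+1).-1 = -1 :> rat by rewrite mulrN1.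
by rewrite -signr_odd mulnS add2n /= oddM.
Qed.

Lemma even_double n : ~~ odd (2 * n). Proof. by rewrite oddM. Qed.

(** The end terms give - [y_i, A^ij_2n + A^ik_2n]. In the middle, the squares give the two [beta],
    and the cross term of A^ij and A^ik is [y_i, A^jk_2n] by [y_ad_t], which completes T. *)
Lemma ad_t_sum_y i j k n : uniq [:: i; j; k] ->
  half_altsum (fun p => iter p (ad (xg true i)) (xg false i)) (2 * n + 2)
    = [lie ad_t_sum i j k n, xg false i] + (beta i j n + beta i k n).
Proof.
move=> u; have u2 := uniq3_rot u; have u3 := uniq3_rot u2.
rewrite half_altsum_recl_recr addn1 (iter_ad_yE _ u) [X in half_altsum X]/comp.
rewrite (_ : (fun _ => _) = fun p => - (ad_t i j p + ad_t i k p)); last first.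
  by apply: funext => p; apply: iter_ad_yE.
rewrite half_altsumN half_altsumD ?even_double //.
have -> : altsum (ad_t i j) (ad_t i k) (2 * n) = [lie xg false i, ad_t j k (2 * n)].
  rewrite (y_ad_t _ u2) altsumC exprM expr2 mulrNN mulr1 expr1n !scale1r.
  apply: eq_bigr => a _; rewrite (ad_tC _ (uniq3_swap u3)) bracketZl.
  by [].
rewrite [LHS]/= [X in _ = X + _]bracketC bracketNr /ad_t_sum.
rewrite (ad_t_evenC n (uniq3_swap u3)) !bracketDr /beta !opprD.
by rewrite [LHS](AC (2*(2*1)) ((1*5*2)*(3*4))).
Qed.

(** On A^ij, ad x_i is the shift of the index, so [altsum_shift] applies. *)
Lemma x_beta i j k n : uniq [:: i; j; k] ->
  [lie xg true i, beta i j n] = [lie ad_t i j (2 * n), tij i j].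
Proof.
move=> u; rewrite bracketNr -/(ad (xg true i) (half_altsum _ _)).
rewrite half_altsum_der ?even_double //; last exact: ad_derivation.
by rewrite -[altsum _ _ _]/(altsum (ad_t i j \o S) _ _) altsum_shift opprK.
Qed.

Lemma x_beta_kill i j k n : uniq [:: i; j; k] ->
  [lie xg true k, beta i j n] = 0.
Proof.
move=> u; rewrite bracketNr -/(ad (xg true k) (half_altsum _ _)).
rewrite half_altsum_der ?even_double //; last exact: ad_derivation.
rewrite /altsum big1 ?oppr0 // => a _.
by rewrite /ad (ad_t_kill _ u) bracket0l scaler0.
Qed.

(** [half_altsum_der] differentiates one factor only; the sign of [y_ad_t] squares away against the
    alternating one. *)
Lemma y_beta i j k n : uniq [:: i; j; k] ->
  [lie xg false k, beta i j n]
    = - trisum (fun a b c => [lie [lie ad_t j k a, ad_t k i b], ad_t i j c])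
        (2 * n).
Proof.
move=> u; rewrite bracketNr -/(ad (xg false k) (half_altsum _ _)).
rewrite half_altsum_der ?even_double //; last exact: ad_derivation.
congr (- _); apply: eq_bigr => p _; rewrite /ad (y_ad_t _ u).
by rewrite bracketZl scalerA -expr2 sqrr_sign scale1r bracket_suml.
Qed.

(* The three sums of [y_beta] add up to Jacobi identities. *)
Lemma y_beta_cycle i j k n : uniq [:: i; j; k] ->
  [lie xg false k, beta i j n] + [lie xg false i, beta j k n]
    + [lie xg false j, beta k i n] = 0.
Proof.
move=> u; have u2 := uniq3_rot u; have u3 := uniq3_rot u2.
rewrite (y_beta n u) (y_beta n u2) (y_beta n u3).
(* The third sum is rotated twice and the second once, so that a always belongs to jk, b to ki and c
   to ij. *)
rewrite [X in _ - X]trisum_rot [X in _ - X]trisum_rot.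
rewrite [X in _ - X - _]trisum_rot -!opprD; apply/eqP; rewrite oppr_eq0; apply/eqP.
rewrite /trisum -!big_split big1 //= => p _; rewrite -!big_split big1 //= => a _.
set x := ad_t j k _; set y := ad_t k i _; set z := ad_t i j _.
rewrite (bracketC [lie x, y] z) (bracketC [lie y, z] x) (bracketC [lie z, x] y).
rewrite -!opprD.
by apply/eqP; rewrite oppr_eq0 addrAC -[X in X + _]addrC jacobi.
Qed.

(** [alpha_s^(i,jk)] for the pair [delta n], see [ell_ins_delta]. *)
Definition alpha_ins s i n : t13 :=
  if s then iter (2 * n + 2) (ad (xg true i)) (xg false i)
  else half_altsum (fun p => iter p (ad (xg true i)) (xg false i)) (2 * n + 2).

Lemma alpha_insE s i j k n : uniq [:: i; j; k] ->
  alpha_ins s i n = [lie ad_t_sum i j k n, xg s i]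
    + (if s then 0 else beta i j n + beta i k n).
Proof.
by case: s => u; rewrite /alpha_ins ?addr0 ?(ad_t_sum_x _ u) // (ad_t_sum_y _ u).
Qed.

(** The inner parts add up to the bracket of T with x_i + x_j + x_k = 0; the [beta] cancel in
    antisymmetric pairs. *)
Lemma alpha_ins_sum s i j k n : uniq [:: i; j; k] ->
  alpha_ins s i n + alpha_ins s j n + alpha_ins s k n = 0.
Proof.
move=> u; have u2 := uniq3_rot u; have u3 := uniq3_rot u2.
rewrite (alpha_insE s n u) (alpha_insE s n u2) (alpha_insE s n u3).
rewrite (ad_t_sum_rot j k i) (ad_t_sum_rot i j k).
rewrite (AC (2*2*2) ((1*3*5)*(2*4*6))) /= -!bracketDr (xg3_sum s u) bracket0r add0r.
case: s; first by rewrite !addr0.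
rewrite (betaC n u) (betaC n u2) (betaC n u3).
by rewrite (AC (2*2*2) ((1*4)*(3*6)*(5*2))) /= !addrN !addr0.
Qed.

Lemma alpha_ins_xx s i j k n : uniq [:: i; j; k] ->
  [lie xg s i, alpha_ins s j n] + [lie alpha_ins s i n, xg s j] = 0.
Proof.
move=> u; have u2 := uniq3_rot u; have u3 := uniq3_rot u2.
rewrite (alpha_insE s n u) (alpha_insE s n u2) (ad_t_sum_rot i j k).
rewrite bracket_der_perturb xg_comm bracket0r add0r.
case: s; first by rewrite bracket0r bracket0l addr0.
rewrite [X in _ + X]bracketC !bracketDr (betaC n u) (betaC n u3).
rewrite 2!(bracketNr _ (beta _ _ _)).
(* As y_i + y_j = - y_k, the two brackets with beta_ij merge into the missing term of
   [y_beta_cycle]. *)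
have yN : [lie xg false i, beta i j n] + [lie xg false j, beta i j n]
    = - [lie xg false k, beta i j n] :> t13.
  apply/eqP; rewrite -addr_eq0 -!bracketDl.
  by rewrite (xg3_sum false u) bracket0l.
rewrite opprD opprK (AC (2*2) ((1*4)*(2*3))) /= -opprD yN opprK addrC addrA.
exact: y_beta_cycle n u.
Qed.

(** The inner part leaves [T, t_ij] = [x_i, beta_ij], which cancels against [x_i, beta_ji]; x_i
    kills beta_jk. *)
Lemma alpha_ins_xy i j k n : uniq [:: i; j; k] ->
  [lie xg true i, alpha_ins false j n] + [lie alpha_ins true i n, xg false j] = 0.
Proof.
move=> u; have u2 := uniq3_rot u.
rewrite (alpha_insE true n u) (alpha_insE false n u2) (ad_t_sum_rot i j k).
rewrite bracket_der_perturb -/(tij i j) (ad_t_sum_t n u) bracket0l addr0.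
by rewrite bracketDr (betaC n u) (bracketNr _ (beta i j n)) (x_beta n u)
  (x_beta_kill n u2) add0r addrN.
Qed.
End ThreeStrands.

(** * Membership of delta_2n in r_ell^gr and its bidegree *)

Lemma uniq_inord3 : uniq [:: inord 0; inord 1; inord 2 : 'I_3].
Proof. by rewrite /= !inE -!val_eqE /= !inordK. Qed.

Lemma big_blocks3 n (V : nmodType) l (i : 'I_n) (F : 'I_3 -> V) :
  \sum_(a in blocks l i) F a =
    \sum_(k <- [:: 1; 2; 3]%N | k \in nth [::] l i) F (inord k.-1).
Proof.
rewrite big_mkcond [RHS]big_mkcond /= !big_ord_recl big_ord0 !big_cons big_nil.
rewrite !inE /=.
by congr (_ + (_ + (_ + _))); case: ifP => // _; congr F;
  apply/val_inj; rewrite /= inordK.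
Qed.

Lemma ell_ins_gen I J s (i : 'I_2) :
  all (fun a => blocks_count 2 [:: I; J] a == 1)%N (iota 0 3) ->
  ell_ins I J (xg s i) =
    \sum_(k <- [:: 1; 2; 3]%N | k \in nth [::] [:: I; J] i) x3 s k.
Proof.
by move=> h; rewrite /ell_ins t1_cab_gen ?big_blocks3 //; apply: blocks_partition.
Qed.

Lemma delta_minus n :
  (delta n).2 = half_altsum (fun p => iter p (ad x1) y1) (2 * n + 2).
Proof.
have e : (2 * n + 1 = (2 * n + 2).-1)%N by lia.
by congr (_ *: _); apply: eq_bigr => p _; rewrite e.
Qed.

(** Both components are Lie polynomials in x_1 and y_1, whose images are read off the first
    block. *)
Lemma ell_ins_delta J s n k : (k <= 2)%N ->
  all (fun a => blocks_count 2 [:: [:: k.+1]; J] a == 1)%N (iota 0 3) ->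
  ell_ins [:: k.+1] J (pm (delta n) s) = alpha_ins s (inord k) n.
Proof.
move=> k2 h; have mor := ell_ins_morphism h.
have xE e : ell_ins [:: k.+1] J (xg e ord0) = xg e (inord k).
  rewrite ell_ins_gen // !big_cons big_nil !inE.
  by case: k {h mor} k2 => [|[|[|]]] // _; rewrite /= ?addr0.
case: s; first by rewrite /= (iter_ad_morph _ _ _ mor) !xE.
rewrite [pm _ _]delta_minus (half_altsum_morph _ _ mor); congr (_ *: _).
by apply: eq_bigr => a _; rewrite !(iter_ad_morph _ _ _ mor) !xE.
Qed.

Lemma delta_r_ell_gr n : r_ell_gr (delta n).
Proof.
have u := uniq_inord3.
split=> [s|s|]; rewrite -?[(delta n).1]/(pm (delta n) true)
  -?[(delta n).2]/(pm (delta n) false) !ell_ins_delta //.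
- exact: alpha_ins_sum.
- exact: alpha_ins_xx u.
- exact: alpha_ins_xy u.
Qed.

Lemma iter_ad_bideg p : t12_bideg p%:Z 1 (iter p (ad x1) y1).
Proof.
elim: p => [|p IH]; first exact: BD_y.
by have := BD_br BD_x IH; rewrite add0r -[1 + _]/(1%N + p)%:Z.
Qed.

Lemma delta_plus_bideg n : t12_bideg (1 + (2 * n + 1)%N%:Z) 1 (delta n).1.
Proof.
have -> : 1 + (2 * n + 1)%N%:Z = (2 * n + 2)%N%:Z by lia.
exact: iter_ad_bideg.
Qed.

Lemma delta_minus_bideg n : t12_bideg (2 * n + 1)%N%:Z (1 + 1) (delta n).2.
Proof.
apply: BD_scale; apply: big_ind => [|u v|p _]; [exact: BD_0|exact: BD_add|].
apply: BD_scale; have := BD_br (iter_ad_bideg p) (iter_ad_bideg (2 * n + 1 - p)).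
by rewrite -PoszD subnKC //; have := ltn_ord p; lia.
Qed.

Lemma D_ell_bideg a p q : t12_bideg (1 + p) q a.1 -> t12_bideg p (1 + q) a.2 ->
  forall k l u, t12_bideg k l u -> t12_bideg (k + p) (l + q) (D_ell a u).
Proof.
move=> ax ay k l u; have dD := D_ell_derivation a; have [DD DZ DB] := dD.
elim=> {k l u} [|||k l u v _ hu _ hv|k l c u _ hu|k l k' l' u v bu hu bv hv].
- by rewrite D_ell_x add0r.
- by rewrite D_ell_y add0r.
- by move=> k l; rewrite (is_derivation0 dD); apply: BD_0.
- by rewrite DD; apply: BD_add.
- by rewrite DZ; apply: BD_scale.
- rewrite DB; apply: BD_add; last by rewrite -!addrA; apply: BD_br.
  by rewrite (addrAC k) (addrAC l); apply: BD_br.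
Qed.

(** * delta_0 as an inner derivation *)

Lemma t12_12E : t12_12 = - [lie x1, y1].
Proof.
by rewrite /t12_12 t_to_t1_tg /= (xg2 false) /= scaleN1r bracketNr.
Qed.

(** For n = 0 the sum in alpha_- has two terms, both equal to [y_1, [x_1, y_1]]. *)
Lemma delta0E : delta 0 = (ad t12_12 x1, ad t12_12 y1).
Proof.
rewrite [delta 0]surjective_pairing delta_minus (half_altsum_recl_recr _ 0).
rewrite /half_altsum /altsum big_ord0 scaler0 subr0 t12_12E /ad !bracketNl.
by congr pair; exact: bracketC.
Qed.

Lemma pres_derivation_ext X R (D E : @presented X R -> presented R) :
  is_derivation D -> is_derivation E ->
  (forall x, D (pres_gen R x) = E (pres_gen R x)) -> D =1 E.
Proof.
move=> dD dE DE; have [DD DZ DB] := dD; have [ED EZ EB] := dE.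
elim/quotW; elim=> [x||s hs t ht|c s hs|s hs t ht].
- exact: DE.
- by rewrite [LHS](is_derivation0 dD) [RHS](is_derivation0 dE).
- by rewrite pres_piD DD ED hs ht.
- by rewrite pres_piZ DZ EZ hs.
- by rewrite pres_pi_br DB EB hs ht.
Qed.

Lemma D_ell_inner u : D_ell (ad u x1, ad u y1) =1 ad u.
Proof.
have dD := D_ell_derivation (ad u x1, ad u y1); have [_ DZ _] := dD.
apply: pres_derivation_ext (ad_derivation u) _ => // -[s i].
rewrite -/(xg s i) xg2 DZ /ad bracketZr; congr (_ *: _).
by case: s; rewrite ?D_ell_x ?D_ell_y.
Qed.

(** * Forgetting the last strand *)

Definition forget_last n : t1_alg n.+1 -> t1_alg n :=
  pres_lift (fun si : bool * 'I_n.+1 =>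
    if unlift ord_max si.2 is Some j then xg si.1 j else 0).

Lemma forget_last_rel n s t : @t1_rel n.+1 s t ->
  let f := fun si : bool * 'I_n.+1 =>
    if unlift ord_max si.2 is Some j then xg si.1 j else 0 : t1_alg n in
  lie_eval f s = lie_eval f t.
Proof.
case=> [e|e i j ij|i j ij|e i j k].
- move=> f; rewrite lie_eval_sum big_ord_recr /= /f /= unlift_none addr0.
  rewrite -[RHS](xg_sum n e); apply: eq_bigr => i _.
  rewrite (_ : widen_ord _ i = lift ord_max i) ?liftK //.
  by apply: val_inj; rewrite [RHS]lift_max.
- rewrite /=; case: unliftP => [i' _|_]; last exact: bracket0l.
  by case: unliftP => [j' _|_]; rewrite ?xg_comm ?bracket0r.
- rewrite /=; move: ij; case: unliftP => [i' ->|_]; case: unliftP => [j' ->|_] ij;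
    rewrite ?bracket0l ?bracket0r //.
  by apply: xg_sym; apply: contraNneq ij => ->.
- rewrite /=; case: unliftP => [i' ->|_]; case: unliftP => [j' ->|_];
    case: unliftP => [k' ->|_]; rewrite ?bracket0l ?bracket0r // => u.
  apply: xg_br3; rewrite -(map_inj_uniq (@lift_inj _ ord_max)); exact: u.
Qed.

Lemma forget_last_morphism n : is_lie_morphism (@forget_last n).
Proof. exact/pres_lift_morphism/forget_last_rel. Qed.

Lemma forget_last_xg n s (i : 'I_n.+1) :
  forget_last (xg s i) = if unlift ord_max i is Some j then xg s j else 0.
Proof. by rewrite [LHS]pres_lift_gen //; apply: forget_last_rel. Qed.

(** Labels start from 1, so the first entry of the list is a filler; strand 2 gives - x_1 because
    x_2 = - x_1 in t_{1,2}. *)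
Lemma forget_last_x3 s k : k \in [:: 1; 2; 3]%N ->
  forget_last (x3 s k) = nth 0 [:: 0; xg s ord0; - xg s ord0; 0] k :> t12.
Proof.
have lE (j : 'I_2) : inord j = lift ord_max j :> 'I_3.
  by apply: val_inj; rewrite [RHS]lift_max /= inordK // ltnS ltnW.
rewrite /x3 !inE => /or3P[] /eqP -> /=; rewrite forget_last_xg.
- by rewrite (lE ord0) liftK.
- by rewrite (lE ord_max) liftK [LHS]xg2 /= scaleN1r.
- by rewrite (_ : inord 2 = ord_max) ?unlift_none //; apply: val_inj;
  rewrite /= inordK.
Qed.

Definition forget3 I J (a : t12) : t12 := forget_last (ell_ins I J a).

Lemma forget3_morphism I J :
  all (fun a => blocks_count 2 [:: I; J] a == 1)%N (iota 0 3) ->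
  is_lie_morphism (forget3 I J).
Proof.
move=> h; have [eD eZ eB] := ell_ins_morphism h.
have [fD fZ fB] := forget_last_morphism 2.
by split=> *; rewrite /forget3 ?(eD, eZ, eB) ?(fD, fZ, fB).
Qed.

Lemma forget3_xg I J s (i : 'I_2) :
  all (fun a => blocks_count 2 [:: I; J] a == 1)%N (iota 0 3) ->
  forget3 I J (xg s i) =
    \sum_(k <- [:: 1; 2; 3]%N | k \in nth [::] [:: I; J] i)
      nth 0 [:: 0; xg s ord0; - xg s ord0; 0] k.
Proof.
move=> h; have fM := forget_last_morphism 2; have [fD _ _] := fM.
rewrite /forget3 ell_ins_gen // (big_morph _ fD (lie_morphism0 fM)).
by rewrite big_seq_cond [RHS]big_seq_cond; apply: eq_bigr => k /andP[/forget_last_x3].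
Qed.

Lemma forget3_1_23 : forget3 [:: 1]%N [:: 2; 3]%N =1 id.
Proof.
apply: pres_morphism_ext => // [|[s i]]; first exact: forget3_morphism.
rewrite -/(xg s i) forget3_xg // !big_cons big_nil.
by case: i => [[|[|//]] hi] /=; rewrite !addr0 [RHS]xg2 /= ?scale1r ?scaleN1r.
Qed.

Lemma forget3_3_12 : forget3 [:: 3]%N [:: 1; 2]%N =1 fun=> 0.
Proof.
apply: pres_morphism_ext => // [||[s i]]; first exact: forget3_morphism.
  by split=> *; rewrite ?addr0 ?scaler0 ?bracket0r.
rewrite -/(xg s i) forget3_xg // !big_cons big_nil.
by case: i => [[|[|//]] hi] /=; rewrite ?addr0 ?addrN.
Qed.

Lemma forget3_2_31 : forget3 [:: 2]%N [:: 3; 1]%N =1 forget3 [:: 2]%N [:: 1; 3]%N.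
Proof.
apply: pres_morphism_ext => // [||[s i]]; try exact: forget3_morphism.
by rewrite -/(xg s i) !forget3_xg // !big_cons !big_nil; case: i => [[|[|//]] hi].
Qed.

(** What psi^(1,2,3) and psi^(2,1,3) both become without strand 3: A stays t_12, while B involves
    t_23 or t_13 and dies. *)
Definition f2_t12 : f2 -> t12 := pres_lift (fun b : bool => if b then t12_12 else 0).

(** The centralizer of t_12 is a subalgebra containing the images of A and B. *)
Lemma f2_t12_comm psi : [lie t12_12, f2_t12 psi] = 0.
Proof.
have mor : is_lie_morphism f2_t12 by apply: pres_lift_morphism.
have [mD mZ mB] := mor.
elim/quotW: psi; elim=> [x||s hs t ht|c s hs|s hs t ht].
- by rewrite [f2_t12 _]pres_lift_gen //; case: x; rewrite ?bracketxx ?bracket0r.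
- by rewrite [f2_t12 _](lie_morphism0 mor) bracket0r.
- by rewrite pres_piD mD bracketDr hs ht addr0.
- by rewrite pres_piZ mZ bracketZr hs scaler0.
- by rewrite pres_pi_br mB bracket_comm.
Qed.

Lemma big_block1 n (V : nmodType) l (i : 'I_n) k (F : 'I_3 -> V) :
  nth [::] l i = [:: k] -> k \in [:: 1; 2; 3]%N ->
  \sum_(a in blocks l i) F a = F (inord k.-1).
Proof.
move=> lk k3; apply: big_pred1 => a; rewrite !inE lk inE /= -val_eqE /=.
by move: k3; rewrite !inE => /or3P[] /eqP ->; rewrite inordK.
Qed.

Lemma f2_ins3_gen I J K b :
  all (fun a => blocks_count 3 [:: [:: I]; [:: J]; [:: K]] a <= 1)%N (iota 0 3) ->
  {subset [:: I; J; K] <= [:: 1; 2; 3]%N} ->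
  f2_ins 3 [:: I] [:: J] [:: K] (pres_gen _ b) =
    if b then t3g I J else t3g J K.
Proof.
move=> h sub; rewrite /f2_ins /f2_to_t3 pres_lift_gen //.
have cabE (i j : 'I_3) : i != j -> t_cab (blocks [:: [:: I]; [:: J]; [:: K]]) (tg i j)
   = t3g (nth 0%N [:: I; J; K] i) (nth 0%N [:: I; J; K] j).
  move=> ij; rewrite [LHS]pres_lift_gen /=; last first.
    by move=> *; apply: t_cab_rel => //; apply: blocks_disjoint.
  have nE (m : 'I_3) : nth [::] [:: [:: I]; [:: J]; [:: K]] m
      = [:: nth 0%N [:: I; J; K] m] by case: m => [[|[|[|]]]].
  have m3 (m : 'I_3) : nth 0%N [:: I; J; K] m \in [:: 1; 2; 3]%N.
    by apply/sub/mem_nth/ltn_ord.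
  by rewrite (negbTE ij) (big_block1 _ (nE i) (m3 i)) (big_block1 _ (nE j) (m3 j)).
by case: b; rewrite cabE ?inordK // -val_eqE /= !inordK.
Qed.

Lemma forget_psi_ins I J psi : (I, J) \in [:: (1, 2); (2, 1)]%N ->
  forget_last (psi_ins [:: I] [:: J] [:: 3]%N psi) = f2_t12 psi.
Proof.
move=> IJ.
have h : all (fun a => blocks_count 3 [:: [:: I]; [:: J]; [:: 3]] a <= 1)%N (iota 0 3).
  by move: IJ; rewrite !inE => /orP[] /eqP[-> ->].
have [fD fZ fB] := f2_ins_morphism h.
have [tD tZ tB] := t_to_t1_morphism 3.
have [gD gZ gB] := forget_last_morphism 2.
apply: (pres_morphism_ext
  (f := fun psi => forget_last (psi_ins [:: I] [:: J] [:: 3]%N psi))) psi.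
- by rewrite /psi_ins; split=> *; rewrite ?(fD, fZ, fB) ?(tD, tZ, tB) ?(gD, gZ, gB).
- exact: pres_lift_morphism.
move=> b; rewrite /psi_ins f2_ins3_gen //; last first.
  by move: IJ; rewrite !inE => /orP[] /eqP[-> ->] k; rewrite !inE => /or3P[] /eqP ->.
rewrite [RHS]pres_lift_gen // (fun_if (@t_to_t1 3)) (fun_if (@forget_last 2)).
have E i j : i \in [:: 1; 2; 3]%N -> j \in [:: 1; 2; 3]%N -> i != j ->
    forget_last (t_to_t1 (t3g i j))
    = [lie nth 0 [:: 0; x1; - x1; 0] i, nth 0 [:: 0; y1; - y1; 0] j].
  move=> i3 j3 ij; rewrite t_to_t1_tg ifN ?gB -?/(x3 true i) -?/(x3 false j).
    by rewrite !forget_last_x3.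
  rewrite -val_eqE /= !inordK; move: i3 j3 ij; rewrite !inE; lia.
by move: IJ; rewrite t12_12E !inE => /orP[] /eqP[-> ->]; case: b;
  rewrite E //= ?bracket0r ?bracketNl ?bracketNr.
Qed.

Lemma grt1_ell_t12 g : grt1_ell g -> D_ell g.2 t12_12 = 0.
Proof.
case: g => psi a [_ h1 _ h3].
have fM := forget_last_morphism 2; have [fD fZ fB] := fM.
(* In the first relation alpha^(3,12) dies, and the terms in psi become [x_1, c] + [x_2, c] = 0 with
   c = [f2_t12 psi]. *)
have anti s : forget3 [:: 2]%N [:: 1; 3]%N (pm a s) = - pm a s.
  have := congr1 (@forget_last 2) (h1 s); rewrite (lie_morphism0 fM) !fD !fB.
  rewrite !forget_psi_ins // !forget_last_x3 //= bracketNl.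
  rewrite -/(forget3 _ _ _) -/(forget3 [:: 2]%N _ _) -/(forget3 [:: 3]%N _ _).
  rewrite forget3_1_23 forget3_2_31 forget3_3_12 addr0 addrK => /eqP.
  by rewrite addrC addr_eq0 => /eqP.
have := congr1 (@forget_last 2) h3.
rewrite !(lie_morphismB _ _ fM) !fB !forget_psi_ins // !forget_last_x3 //=.
rewrite -/(forget3 [:: 2]%N _ _) -/(forget3 [:: 1]%N _ _).
rewrite (anti false) forget3_1_23 => h.
have [_ DZ DB] := D_ell_derivation a.
rewrite t12_12E -scaleN1r DZ DB D_ell_x D_ell_y.
suff -> : [lie a.1, y1] + [lie x1, a.2] = 0 by rewrite scaler0.
(* The right-hand side of the third relation is now [[x_1, y_1], c], which vanishes because c
   commutes with t_12. *)
have := f2_t12_comm psi; rewrite t12_12E bracketNl => /eqP.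
rewrite oppr_eq0 => /eqP c0; move: h; rewrite bracketNr !bracketNl bracketNr !opprK.
rewrite (bracket_der x1 y1) c0 add0r addNr (bracketC y1) -opprD => /eqP.
by rewrite oppr_eq0 addrC => /eqP.
Qed.

(** * Brackets with delta_0 in grt_ell *)

Lemma D_ell0 u : D_ell 0 u = 0.
Proof.
rewrite (_ : (0 : t12 * t12) = (ad 0 x1, ad 0 y1)); last by rewrite /ad !bracket0l.
by rewrite D_ell_inner /ad bracket0l.
Qed.

Lemma D_grt0 u : D_grt 0 u = 0.
Proof.
rewrite -[RHS](bracket0l u); apply: (pres_derivation_ext (E := ad 0)) => [||b].
- exact: f2_der_derivation.
- exact: ad_derivation.
- by rewrite /ad bracket0l; case: b; rewrite [LHS]pres_der_gen ?bracket0l.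
Qed.

(** As D_alpha kills t_12, it commutes with ad t_12, the derivation given by [delta 0]. *)
Lemma delta0_central g : grt1_ell g ->
  grt_ell_bracket (r_incl (delta 0)) (g, 0) = 0.
Proof.
move=> gg; have t0 := grt1_ell_t12 gg; case: g gg t0 => psi a gg t0.
have [_ _ DB] := D_ell_derivation a.
have Dd u : D_ell a (ad t12_12 u) = D_ell (delta 0) (D_ell a u).
  by rewrite delta0E D_ell_inner /ad DB t0 bracket0l add0r.
have d1 : D_ell a (delta 0).1 = D_ell (delta 0) a.1.
  by rewrite {1}delta0E Dd D_ell_x.
have d2 : D_ell a (delta 0).2 = D_ell (delta 0) a.2.
  by rewrite {1}delta0E Dd D_ell_y.
have dG : D_grt psi 0 = 0 by exact/is_derivation0/f2_der_derivation.
rewrite /grt_ell_bracket /r_incl /grt1_ell_bracket /ad_e22 /grt_bracket /=.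
by rewrite d1 d2 bracket0l dG D_grt0 !addrN !scale0r !addr0 !subr0.
Qed.

(** The components have deg_- equal to 1 and 2, so the factors - deg_- and 1 - deg_- are both -1:
    [e22] acts on [delta 0] by -1, not by 0. *)
Lemma e22_delta0 : grt_ell_bracket e22 (r_incl (delta 0)) = - r_incl (delta 0).
Proof.
have D0 a : D_ell a 0 = 0 by apply/is_derivation0/D_ell_derivation.
have f0 : f2_deg 0 = 0 by apply/is_derivation0/f2_der_derivation.
have := t12_degmE (delta_plus_bideg 0); have := t12_degmE (delta_minus_bideg 0).
rewrite /r_incl; case: (delta 0) => u v /= dv du.
rewrite /grt_ell_bracket /grt1_ell_bracket /ad_e22 /grt_bracket /= du dv.
rewrite bracket0l D_grt0 !D_ell0 !D0 f0 !scale0r !scale1r !subr0 !add0r.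
rewrite [(1 + 1)%:~R *: v]scalerDl !scale1r opprD addrA addrN add0r.
by rewrite -[RHS]/(- 0, (- u, - v), - 0) !oppr0.
Qed.

Theorem proposition4p19 :
  (forall n : nat, r_ell_gr_bideg (2 * n + 1)%N%:Z 1 (delta n)) /\
  (grt_ell (r_incl (delta 0)) /\
   (forall g : f2 * (t12 * t12), grt1_ell g ->
      grt_ell_bracket (r_incl (delta 0)) (g, 0) = 0) /\
   grt_ell_bracket e22 (r_incl (delta 0)) = - r_incl (delta 0)) /\
  D_ell (delta 0) =1 ad t12_12.
Proof.
split=> [n|].
  split; first exact: delta_r_ell_gr.
  exact: D_ell_bideg (delta_plus_bideg n) (delta_minus_bideg n).
split; last by rewrite delta0E; apply: D_ell_inner.
split; last by split; [exact: delta0_central|exact: e22_delta0].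
(* Membership in [grt_ell] is read off the description of the kernel. *)
have : ([set r_incl a | a in r_ell_gr] (r_incl (delta 0)))%classic.
  by exists (delta 0) => //; apply: delta_r_ell_gr.
by rewrite -ker_grt_ell_to_grt => -[].
Qed.
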